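(* Let $\overline{\mathbb S}$ be a countable family of models, $\Delta$ a weight function, $\mathbf S$ and the penalty function $\mathrm{pen}$ be as in the context. If $$\mathrm{pen}(\mathbf t)\ge\mathrm{pen}_1(\mathbf t)=\inf_{\{S\in\mathbb S\,|\,S\ni\mathbf t\}}\Big\{\tfrac18\overline D^S+\kappa\Delta(\overline S)\Big\}\quad\text{for all }\mathbf t\in\mathbf S,$$ then any (measurably chosen) element $\widehat{\mathbf s}$ in $\mathrm{Cl}(\mathcal E(\boldsymbol X,\mathbf S))$ satisfies, for all $\mathbf s\in\mathcal L_0$ and $\xi>0$, $$\mathbb P_{\mathbf s}\Big[\mathbf h^2(\mathbf s,\widehat{\mathbf s})\le\inf_{\overline{\mathbf s}\in\mathbf S}\big\{c_1\mathbf h^2(\mathbf s,\overline{\mathbf s})+8c_2\,\mathrm{pen}(\overline{\mathbf s})\big\}+c_3(1.45+\xi)\Big]\ge1-e^{-\xi}.$$ In particular, if $\mathrm{pen}(\mathbf t)=\mathrm{pen}_1(\mathbf t)$ for all $\mathbf t\in\mathbf S$ and the sets $S\in\mathbb S$ are chosen in order to satisfy $$2c_1\sup_{\mathbf u\in\overline S}\mathbf h^2(\mathbf u,S)+c_2\overline D^S\le\overline D(\overline S)+\frac{c_3}{20},$$ then for all $\mathbf s\in\mathcal L_0$ and $\xi>0$, $$\mathbb P_{\mathbf s}\Big[\mathbf h^2(\mathbf s,\widehat{\mathbf s})\le\inf_{\overline S\in\overline{\mathbb S}}\big\{2c_1\mathbf h^2(\mathbf s,\overline S)+\overline D(\overline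 S)+c_3(\Delta(\overline S)+1.5+\xi)\big\}\Big]\ge1-e^{-\xi}.$$
   Context: Setting. Let $n\ge3$. For $1\le i\le n$, $(\mathcal X_i,\mathcal A_i,\mu_i)$ is a measured space and $\mathcal L_i$ is the set of probability densities with respect to $\mu_i$; $\mathcal L_0=\prod_{i=1}^n\mathcal L_i$, with elements $\mathbf t=(t_1,\dots,t_n)$. $\boldsymbol X=(X_1,\dots,X_n)$ is a vector of independent random variables, $X_i$ having values in $\mathcal X_i$ and density $s_i$ with respect to $\mu_i$; $\mathbf s=(s_1,\dots,s_n)$, and $\mathbb P_{\mathbf s},\mathbb E_{\mathbf s}$ denote probability and expectation for this distribution. For densities $u,v\in\mathcal L_i$, $h^2(u,v)=\frac12\int(\sqrt u-\sqrt v)^2d\mu_i$ and $\rho(u,v)=\int\sqrt{uv}\,d\mu_i$; for $\mathbf t,\mathbf t'\in\mathcal L_0$, $\mathbf h^2(\mathbf t,\mathbf t')=\sum_{i=1}^nh^2(t_i,t_i')$ and $\mathbf h(\mathbf t,S)=\inf_{\mathbf u\in S}\mathbf h(\mathbf t,\mathbf u)$. $S\subset\mathcal L_0$ is identifiable if $\mathbf h(\mathbf u,\mathbf u')>0$ for all distinct $\mathbf u,\mathbf u'\in S$. A model is a nonempty separable subset of $(\mathcal L_0,\mathbf h)$. ''Countable'' means finite or countable. Conventions: $0/0=1$, $x/0=+\infty$ for $x>0$, $0\times(+\infty)=0$, $\sup\varnothing=0$. Constants: $c_0=\frac18(1-\frac1{\sqrt2})$, $c_1=2(7+4\sqrt2)$,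 $c_2=1+\frac1{\sqrt2}$, $\kappa=357$, $c_3=8\kappa c_2$. Dimensions. Let $\psi(u)=\frac{u-1}{\sqrt{1+u^2}}$ for $u\in[0,+\infty)$, $\psi(+\infty)=1$, and $\mathbf Z(\boldsymbol X,\mathbf t,\mathbf t')=\sum_{i=1}^n\{\psi(\sqrt{t_i'/t_i}(X_i))-\mathbb E_{\mathbf s}[\psi(\sqrt{t_i'/t_i}(X_i))]\}$. For countable $S\subset\mathcal L_0$, $\overline{\mathbf s}\in\mathcal L_0$, $y\geq 0$: $\mathcal B^S(\mathbf s,\overline{\mathbf s},y)=\{\mathbf t\in S:\mathbf h^2(\mathbf s,\mathbf t)+\mathbf h^2(\mathbf s,\overline{\mathbf s})\le y^2\}$, $\mathbf w^S(\mathbf s,\overline{\mathbf s},y)=\mathbb E_{\mathbf s}[\sup_{\mathbf t\in\mathcal B^S(\mathbf s,\overline{\mathbf s},y)}|\mathbf Z(\boldsymbol X,\overline{\mathbf s},\mathbf t)|]$ ($0$ if the set is empty), $D^S(\mathbf s,\overline{\mathbf s})=\overline y^2\vee1$ with $\overline y=\sup\{y\ge0:\mathbf w^S(\mathbf s,\overline{\mathbf s},y)>c_0y^2\}$, $\overline D^S=\sup_{(\mathbf s,\overline{\mathbf s})\in\mathcal L_0\times\mathcal L_0}D^S(\mathbf s,\overline{\mathbf s})$, and, for a model $\overline S$, $\overline D(\overline S)=\inf_S[2c_1\sup_{\mathbf u\in\overline S}\mathbf h^2(\mathbf u,S)+c_2\overline D^S]$ over all countable identifiable $S\subset\mathcal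 L_0$. Model selection. $\overline{\mathbb S}$ is a countable family of models in $\mathcal L_0$ and $\Delta:\overline{\mathbb S}\to\mathbb R_+$ satisfies $\sum_{\overline S\in\overline{\mathbb S}}e^{-\Delta(\overline S)}\le1$. To each $\overline S\in\overline{\mathbb S}$ is attached a countable identifiable subset $S$ of $\mathcal L_0$ which is either an $\eta$-net for $\overline S$ (i.e. $\sup_{\mathbf t\in\overline S}\mathbf h(\mathbf t,S)\le\eta$, for some $\eta\geq 0$) or a dense subset of $\overline S$; $\mathbb S$ is the collection of these sets, each $S\in\mathbb S$ corresponding to a model $\overline S\in\overline{\mathbb S}$, and $\mathbf S=\bigcup_{S\in\mathbb S}S$. $\mathrm{pen}$ is a positive function on $\mathbf S$. For $\mathbf t,\mathbf t'\in\mathcal L_0$, $\mathbf r=(\mathbf t+\mathbf t')/2$, $\mathbf T(\boldsymbol X,\mathbf t,\mathbf t')=\frac12\sum_i[\rho(t_i',r_i)-\rho(t_i,r_i)]+\frac1{\sqrt2}\sum_i\psi(\sqrt{t_i'/t_i}(X_i))$; $\overline{\boldsymbol\Upsilon}(\mathbf S,\mathbf t)=\sup_{\mathbf t'\in\mathbf S}\{\mathbf T(\boldsymbol X,\mathbf t,\mathbf t')-\mathrm{pen}(\mathbf t')\}+\mathrm{pen}(\mathbf t)$; $\mathcal E(\boldsymbol X,\mathbf S)=\{\widetilde{\mathbf s}\in\mathbf S:\overline{\boldsymbol\Upsilon}(\mathbf S,\widetilde{\mathbf s})\le\inf_{\mathbf t\in\mathbf S}\overline{\boldsymbol\Upsilon}(\mathbf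 S,\mathbf t)+\kappa/10\}$; $\mathrm{Cl}(\mathcal E(\boldsymbol X,\mathbf S))=\{\mathbf t\in\mathcal L_0:\mathbf h(\mathbf t,\mathcal E(\boldsymbol X,\mathbf S))=0\}$. *)

(* Defs.v *)
From mathcomp Require Import all_boot all_order all_algebra.
From mathcomp Require Import all_classical all_reals all_analysis.

Set Implicit Arguments.
Unset Strict Implicit.
Unset Printing Implicit Defensive.

Import Order.TTheory GRing.Theory Num.Theory.
Import numFieldNormedType.Exports.

Local Open Scope classical_set_scope.
Local Open Scope ring_scope.

Definition c0 (R : realType) : R := 1 / 8 * (1 - 1 / Num.sqrt 2).
Definition c1 (R : realType) : R := 2 * (7 + 4 * Num.sqrt 2).
Definition c2 (R : realType) : R := 1 + 1 / Num.sqrt 2.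
Definition kappa (R : realType) : R := 357.
Definition c3 (R : realType) : R := 8 * kappa R * c2 R.

(* Supremum of a set of nonnegative extended reals, with sup of the empty set
   equal to 0 (the library's [ereal_sup set0] is -oo). *)
Definition esup0 (R : realType) (A : set (\bar R)) : \bar R :=
  if A == set0 then 0%E else ereal_sup A.

(* Densities are genuine functions, not almost-everywhere classes: this is why
   identifiability below is a nontrivial condition. *)
Record density (R : realType) (d : measure_display) (T : measurableType d)
    (mu : {measure set T -> \bar R}) := Density {
  density_fun :> T -> R ;
  density_measurable : measurable_fun setT density_fun ;
  density_ge0 : forall x, 0 <= density_fun x ;
  density_int1 : (\int[mu]_x (density_fun x)%:E = 1)%E }.

(* The quotient b / a of nonnegative reals, with 0 / 0 = 1 and b / 0 = +oo
   for b > 0. *)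
Definition quot (R : realType) (b a : R) : \bar R :=
  if a == 0 then (if b == 0 then 1%E else +oo%E) else (b / a)%:E.

(* The value at -oo is irrelevant: [psi] is only applied to elements of
   [0, +oo]. *)
Definition psi (R : realType) (u : \bar R) : R :=
  match u with
  | r%:E => (r - 1) / Num.sqrt (1 + r ^+ 2)
  | +oo%E => 1
  | -oo%E => -1
  end.

Definition hell2 (R : realType) (d : measure_display) (T : measurableType d)
    (mu : {measure set T -> \bar R}) (u v : T -> R) : R :=
  1 / 2 * \int[mu]_x (Num.sqrt (u x) - Num.sqrt (v x)) ^+ 2.

Definition affinity (R : realType) (d : measure_display) (T : measurableType d)
    (mu : {measure set T -> \bar R}) (u v : T -> R) : R :=
  \int[mu]_x Num.sqrt (u x * v x).

Section ProductDensities.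
Context (R : realType) (n : nat) (d : 'I_n -> measure_display)
  (E : forall i, measurableType (d i))
  (mu : forall i, {measure set (E i) -> \bar R}).

Definition densities : Type := forall i, density (mu i).

Definition Hdist2 (t t' : densities) : R :=
  \sum_(i < n) hell2 (mu i) (t i) (t' i).
Definition Hdist (t t' : densities) : R := Num.sqrt (Hdist2 t t').

Definition Hdist_set (t : densities) (S : set densities) : \bar R :=
  ereal_inf [set (Hdist t u)%:E | u in S].
Definition Hdist_set2 (t : densities) (S : set densities) : \bar R :=
  (Hdist_set t S ^+ 2)%E.

Definition identifiable (S : set densities) : Prop :=
  forall u u', S u -> S u' -> u <> u' -> 0 < Hdist u u'.

Definition dense_subset (D S : set densities) : Prop :=
  D `<=` S /\ forall t, S t -> Hdist_set t D = 0%E.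

Definition is_net (eta : R) (D S : set densities) : Prop :=
  (ereal_sup [set Hdist_set t D | t in S] <= eta%:E)%E.

Definition is_model (S : set densities) : Prop :=
  S !=set0 /\ exists D, countable D /\ dense_subset D S.

Definition Hclosure (S : set densities) : set densities :=
  [set t | Hdist_set t S = 0%E].

Definition Hopen (U : set densities) : Prop :=
  forall t, U t -> exists2 e : R, 0 < e & [set u | Hdist t u < e] `<=` U.

(* Measurability with respect to the Borel sigma-algebra of the pseudometric
   space of product densities. *)
Definition Hmeasurable (d' : measure_display) (Omega : measurableType d')
    (f : Omega -> densities) : Prop :=
  forall U, Hopen U -> measurable (f @^-1` U).

Definition psi_ratio (i : 'I_n) (t t' : densities) (x : E i) : R :=
  psi (sqrte (quot (t' i x) (t i x))).

Definition Tstat (x : forall i, E i) (t t' : densities) : R :=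
  let r i (y : E i) := (t i y + t' i y) / 2 in
  1 / 2 * (\sum_(i < n) (affinity (mu i) (t' i) (r i)
                         - affinity (mu i) (t i) (r i)))
  + 1 / Num.sqrt 2 * \sum_(i < n) psi_ratio t t' (x i).

Definition Upsilon (x : forall i, E i) (S : set densities)
    (pen : densities -> R) (t : densities) : \bar R :=
  (ereal_sup [set (Tstat x t t' - pen t')%:E | t' in S] + (pen t)%:E)%E.

Definition rho_estimators (x : forall i, E i) (S : set densities)
    (pen : densities -> R) : set densities :=
  [set st | S st /\
    (Upsilon x S pen st
     <= ereal_inf [set Upsilon x S pen t | t in S] + (kappa R / 10)%:E)%E].

Section Dimensions.
Context (d' : measure_display) (Omega : measurableType d')
  (P : densities -> probability Omega R) (X : forall i, Omega -> E i).

Definition independent (Q : probability Omega R) : Prop :=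
  forall (J : {set 'I_n}) (A : forall i, set (E i)),
    (forall i, measurable (A i)) ->
    (Q (\bigcap_(i in [set` J]) (X i @^-1` A i))
     = \prod_(i in J) Q (X i @^-1` A i))%E.

(* [P] is the family of distributions P_s: under [P s] the observations are
   independent and the i-th one has density s_i with respect to mu_i. The
   canonical instance is the family of product probabilities on the product
   space, with [X] the coordinate maps. *)
Definition density_experiment : Prop :=
  (forall i, measurable_fun setT (X i)) /\
  forall s, independent (P s) /\
    forall i (A : set (E i)), measurable A ->
      P s (X i @^-1` A) = (\int[mu i]_(x in A) (s i x)%:E)%E.

Definition Zstat (s t t' : densities) (w : Omega) : R :=
  \sum_(i < n) (psi_ratio t t' (X i w)
                - fine ('E_(P s)[fun w' => psi_ratio t t' (X i w')])%E).

Definition Bset (S : set densities) (s sb : densities) (y : R) :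
    set densities :=
  [set t | S t /\ Hdist2 s t + Hdist2 s sb <= y ^+ 2].

Definition wfun (S : set densities) (s sb : densities) (y : R) : \bar R :=
  (\int[P s]_w esup0 [set `|Zstat s sb t w|%:E | t in Bset S s sb y])%E.

Definition ybar (S : set densities) (s sb : densities) : \bar R :=
  esup0 [set y%:E | y in
    [set y : R | 0 <= y /\ ((c0 R * y ^+ 2)%:E < wfun S s sb y)%E]].

Definition dimension (S : set densities) (s sb : densities) : \bar R :=
  maxe (ybar S s sb ^+ 2)%E 1%E.

Definition max_dimension (S : set densities) : \bar R :=
  esup0 [set dimension S p.1 p.2 | p in [set: densities * densities]].

(* The quantity 2 c_1 sup_{u in Sb} h^2(u, S) + c_2 Dbar^S whose infimum over
   the admissible S is the dimension of the model Sb. *)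
Definition dimension_bound (Sb S : set densities) : \bar R :=
  ((2 * c1 R)%:E * esup0 [set Hdist_set2 u S | u in Sb]
   + (c2 R)%:E * max_dimension S)%E.

Definition model_dimension (Sb : set densities) : \bar R :=
  ereal_inf [set dimension_bound Sb S |
    S in [set S | countable S /\ identifiable S]].

(* [net Sb] is the countable set S attached to the model [Sb]. *)
Definition pen1 (models : set (set densities)) (Delta : set densities -> R)
    (net : set densities -> set densities) (t : densities) : \bar R :=
  ereal_inf [set ((1 / 8)%:E * max_dimension (net Sb)
                  + (kappa R * Delta Sb)%:E)%E |
    Sb in [set Sb | models Sb /\ net Sb t]].

End Dimensions.

End ProductDensities.

(* Main.v *)
(** The penalty dominates, on every net [S], the fluctuations of the centred
    process [Z(X, sb, t)], up to a multiple of [h^2(s, t) + h^2(s, sb)] and an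
    error [kappa (xi + 7/5)], off an event of probability [e^-xi]. On the
    complement, the bias bound
    [E T(X, t, t') <= c_2 h^2(s, t) - (1 - 1/sqrt 2) h^2(s, t')], the
    antisymmetry of [T] and the near-minimality of the estimator give the oracle
    inequality by linear arithmetic.

    The fluctuations are controlled by peeling over geometric levels of
    [h^2(s, t) + h^2(s, sb)]. On a level, the mean of the supremum is bounded by
    the definition of the dimension and its deviation by a Talagrand-type
    inequality [E e^(lam N) <= e^(lam (A E N + B v))] for [N = sup_t |sum U_t|],
    with [v] bounding the variances; as [kappa] is large, the single value
    [lam = 1/300] and rough constants [A], [B] suffice.

    For finitely many [t] and finite alphabets (the general case follows by
    discretization) this inequality comes from
    [E e^(sup_t sum (h_t - K h_t^2 - K E h_t^2)) <= e^(E sup_t sum h_t)]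
    for small [h]. It is proved one coordinate at a time, with the supremum
    replaced by the average of the supremum over the coordinates already
    treated. A single coordinate only needs [e^u <= 1 + u + r u^2]: the variance
    of the exponent is at most a multiple of the expected squares along its
    maximizer, which the subtracted squares compensate. Taking
    [h = lam U + 3/2 lam^2 U^2] makes the subtracted square harmless, and
    [E sup_t sum U_t^2] is compared with [E N] by symmetrization and
    contraction. *)
Require Import Defs.
From mathcomp Require Import all_boot all_order all_algebra.
From mathcomp Require Import all_classical all_reals all_analysis.
From mathcomp Require Import measurable_realfun ring lra.

Set Implicit Arguments.
Unset Strict Implicit.
Unset Printing Implicit Defensive.

Import Order.TTheory GRing.Theory Num.Theory.
Import numFieldNormedType.Exports.

Local Open Scope classical_set_scope.
Local Open Scope ring_scope.

(** * An exponential inequality for finite product distributions *)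

Section ExponentialInequality.
Context {R : realType}.

(** With [v = u / 4], the bound [expR (- v) >= 1 - v] gives [expR (- u) >= (1 - v) ^+ 4], so that
    only a polynomial inequality remains. Large negative [u] are covered, which is why only upper
    bounds on deviations matter below. *)
Lemma expR_le_quad (u : R) : u <= 1 / 19 ->
  expR u <= 1 + u + 13 / 20 * u ^+ 2.
Proof.
move=> hu; pose v := u / 4.
have hv : v <= 1 / 76 by rewrite /v; lra.
have e1 : 1 - v <= expR (- v) by have := expR_ge1Dx (- v); lra.
have e4 : (1 - v) ^+ 4 <= expR (- v) ^+ 4.
  by apply: lerXn2r => //; rewrite nnegrE ?expR_ge0 //; lra.
have eu : expR u * expR (- v) ^+ 4 = 1.
  by rewrite -expRM_natl -expRD (_ : u + _ = 0) ?expR0 // /v; lra.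
have q0 : 0 <= 1 + u + 13 / 20 * u ^+ 2.
  have -> : 1 + u + 13 / 20 * u ^+ 2 = (1 + u / 2) ^+ 2 + 2 / 5 * u ^+ 2 by field.
  by rewrite addr_ge0 ?sqr_ge0 // mulr_ge0 ?sqr_ge0 //; lra.
have p1 : 1 <= (1 + u + 13 / 20 * u ^+ 2) * (1 - v) ^+ 4.
  have -> : u = 4 * v by rewrite /v; lra.
  rewrite -subr_ge0.
  (* Value and slope vanish at [v = 0]; the remaining quartic is nonnegative for [v <= 1 / 76]. *)
  have -> : (1 + 4 * v + 13 / 20 * (4 * v) ^+ 2) * (1 - v) ^+ 4 - 1 =
      v ^+ 2 * (2 / 5 - 108 / 5 * v + 237 / 5 * v ^+ 2
                - 188 / 5 * v ^+ 3 + 52 / 5 * v ^+ 4) by field.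
  apply: mulr_ge0; first exact: sqr_ge0.
  have [v0|v0] := leP v 0.
    have v2 : 0 <= v ^+ 2 by exact: sqr_ge0.
    have v4 : 0 <= v ^+ 4 by rewrite (_ : 4 = 2 * 2)%N // exprM sqr_ge0.
    have v3 : v ^+ 3 <= 0 by rewrite exprS; nra.
    lra.
  have v2 : 0 <= v ^+ 2 by exact: sqr_ge0.
  have v4 : 0 <= v ^+ 4 by rewrite (_ : 4 = 2 * 2)%N // exprM sqr_ge0.
  have v3 : v ^+ 3 <= v ^+ 2 by rewrite exprSr; nra.
  lra.
have := le_trans p1 (ler_wpM2l q0 e4).
rewrite -eu ler_pM2r //; exact/exprn_gt0/expR_gt0.
Qed.

Definition pmf (A : finType) (p : A -> R) :=
  (forall x, 0 <= p x) /\ \sum_x p x = 1.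

(* [Phi] is supported from below by affine functions whose slopes are probability
   weights; maxima have this property and averages of translates inherit it. *)
Definition subaff (T : finType) (Phi : (T -> R) -> R) :=
  forall a, exists2 w, pmf w &
    forall b, Phi a + \sum_t w t * (b t - a t) <= Phi b.

Definition maxf (T : finType) (t0 : T) (a : T -> R) : R :=
  a [arg max_(t > t0) a t]%O.

Lemma maxf_ge (T : finType) (t0 : T) (a : T -> R) t : a t <= maxf t0 a.
Proof. by rewrite /maxf; case: arg_maxP => // j _; exact. Qed.

(** The weights at [a] are the point mass at a maximizer of [a]. *)
Lemma subaff_maxf (T : finType) (t0 : T) : subaff (maxf t0).
Proof.
move=> a; set j := [arg max_(t > t0) a t]%O.
exists (fun t => (t == j)%:R).
  split=> [x|]; first exact: ler0n.
  by rewrite (bigD1 j) //= eqxx big1 ?addr0 // => i /negbTE ->.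
move=> b; rewrite (bigD1 j) //= eqxx big1 => [|i /negbTE -> ]; last by rewrite mul0r.
by rewrite mul1r addr0 addrC subrK maxf_ge.
Qed.

Lemma pmf_sum_const (A : finType) (p : A -> R) (c : R) :
  pmf p -> \sum_x p x * c = c.
Proof. by case=> _ p1; rewrite -mulr_suml p1 mul1r. Qed.

Lemma pmf_jensen_sq (A : finType) (p f : A -> R) :
  pmf p -> (\sum_x p x * f x) ^+ 2 <= \sum_x p x * f x ^+ 2.
Proof.
move=> hp; set m := \sum_x p x * f x.
have : 0 <= \sum_x p x * (f x - m) ^+ 2.
  by apply: sumr_ge0 => x _; rewrite mulr_ge0 ?sqr_ge0 //; case: hp.
have -> : \sum_x p x * (f x - m) ^+ 2 =
    \sum_x p x * f x ^+ 2 - 2 * m * m + m ^+ 2.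
  rewrite -[X in _ + X](pmf_sum_const _ hp) [X in _ - X](mulr_sumr) -sumrB.
  by rewrite -big_split; apply: eq_bigr => x _ /=; ring.
by lra.
Qed.

(** The quadratic bound on [expR] is applied to [f x - m], whose linear term has mean zero. Since
    [m] is an average of [f], the oscillation bound controls [f x - m] from above. *)
Lemma pmf_exp_le (A : finType) (p f : A -> R) (m V : R) : pmf p ->
  m = \sum_x p x * f x ->
  (forall x y, f x - f y <= 1 / 19) ->
  \sum_x p x * (f x - m) ^+ 2 <= V ->
  \sum_x p x * expR (f x) <= expR (m + 13 / 20 * V).
Proof.
move=> hp hm osc hV.
have fm x : f x - m <= 1 / 19.
  rewrite -(pmf_sum_const (1 / 19) hp) -{1}(pmf_sum_const (f x) hp) hm -sumrB.
  by apply: ler_sum => y _; rewrite -mulrBr ler_wpM2l //; case: hp.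
rewrite expRD.
have -> : \sum_x p x * expR (f x) = expR m * \sum_x p x * expR (f x - m).
  rewrite mulr_sumr; apply: eq_bigr => x _.
  by rewrite mulrCA -expRD addrC subrK.
rewrite ler_pM2l ?expR_gt0 //.
apply: (@le_trans _ _ (1 + 13 / 20 * V)); last exact: expR_ge1Dx.
apply: (@le_trans _ _ (\sum_x p x * (1 + (f x - m) + 13 / 20 * (f x - m) ^+ 2))).
  apply: ler_sum => x _; apply: ler_wpM2l; first by case: hp.
  exact: expR_le_quad.
have -> : \sum_x p x * (1 + (f x - m) + 13 / 20 * (f x - m) ^+ 2) =
    1 + 13 / 20 * \sum_x p x * (f x - m) ^+ 2.
  transitivity (\sum_x p x * 1 + (\sum_x p x * f x - \sum_x p x * m)
      + 13 / 20 * \sum_x p x * (f x - m) ^+ 2).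
    rewrite -sumrB mulr_sumr -!big_split; apply: eq_bigr => x _ /=; ring.
  by rewrite !pmf_sum_const // -hm subrr addr0.
lra.
Qed.

(** The variance is half the mean of [(f x - f y) ^+ 2] over independent [x] and [y]. Whichever of
    the two values is larger, [q x y + q y x] dominates the square, and both terms have the same
    mean; hence a bound starting from the larger value suffices. *)
Lemma pmf_var_le (A : finType) (p f Q : A -> R) (q : A -> A -> R) : pmf p ->
  (forall x y, 0 <= q x y) ->
  (forall x y, f y <= f x -> (f x - f y) ^+ 2 <= q x y) ->
  (forall x, \sum_y p y * q x y <= Q x) ->
  \sum_x p x * (f x - \sum_y p y * f y) ^+ 2 <= \sum_x p x * Q x.
Proof.
move=> hp q0 hq hQ; set m := \sum_y p y * f y.
have p0 x : 0 <= p x by case: hp.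
have e : 2 * \sum_x p x * (f x - m) ^+ 2 =
    \sum_x p x * \sum_y p y * (f x - f y) ^+ 2.
  have s2 : \sum_x p x * (f x - m) ^+ 2 = \sum_x p x * f x ^+ 2 - m ^+ 2.
    transitivity (\sum_x p x * f x ^+ 2 - 2 * m * m + m ^+ 2); last by ring.
    rewrite -[X in _ + X](pmf_sum_const _ hp) [X in _ - X](mulr_sumr) -sumrB.
    by rewrite -big_split; apply: eq_bigr => x _ /=; ring.
  rewrite s2.
  under [RHS]eq_bigr => x _.
    have -> : \sum_y p y * (f x - f y) ^+ 2 =
        f x ^+ 2 - 2 * f x * m + \sum_y p y * f y ^+ 2.
      rewrite -[X in X - _](pmf_sum_const _ hp) mulr_sumr -sumrB -big_split.
      by apply: eq_bigr => y _ /=; ring.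
    rewrite mulrDr.
    over.
  rewrite big_split /= pmf_sum_const //.
  have -> : \sum_i p i * (f i ^+ 2 - 2 * f i * m) =
      \sum_i p i * f i ^+ 2 - 2 * m * m.
    rewrite [X in _ - X]mulr_sumr -sumrB; apply: eq_bigr => x _; ring.
  ring.
have : 2 * \sum_x p x * (f x - m) ^+ 2 <= 2 * \sum_x p x * Q x.
  rewrite e.
  apply: (@le_trans _ _ (\sum_x p x * (\sum_y p y * q x y)
                        + \sum_x p x * (\sum_y p y * q y x))).
    rewrite -big_split; apply: ler_sum => x _ /=.
    rewrite -mulrDr ler_wpM2l // -big_split; apply: ler_sum => y _ /=.
    rewrite -mulrDr ler_wpM2l //.
    have [h|h] := leP (f y) (f x).
      by rewrite -[leLHS]addr0 lerD // hq.
    by rewrite -[leLHS]add0r lerD // -sqrrN opprB hq // ltW.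
  have -> : \sum_x p x * (\sum_y p y * q y x) = \sum_x p x * (\sum_y p y * q x y).
    under eq_bigr do rewrite mulr_sumr.
    rewrite exchange_big /=; apply: eq_bigr => x _.
    by rewrite mulr_sumr; apply: eq_bigr => y _; rewrite mulrCA.
  rewrite mulr2n mulrDl !mul1r; apply: lerD; apply: ler_sum => x _; exact: ler_wpM2l.
by rewrite ler_pM2l.
Qed.

(** Let [w x] be the weights of [Phi] at the exponent [G x]. They bound [f x - f y] by averages of
    [|h x| + |h y|], hence the variance of [f] by [2 (51/50)^2] times the mean of [Q]. The same
    weights show that dropping the subtracted squares raises [Phi] by at least [7/5 Q], which pays
    for the variance since [13/10 (51/50)^2 <= 7/5]. *)
Lemma subaff_exp_step (A T : finType) (p : A -> R) (h : A -> T -> R)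
    (Phi : (T -> R) -> R) (a : T -> R) :
  pmf p -> subaff Phi -> (forall x t, `|h x t| <= 1 / 80) ->
  \sum_x p x * expR (Phi (fun t => a t + (h x t - 7 / 5 * h x t ^+ 2
                                 - 7 / 5 * \sum_y p y * h y t ^+ 2)))
  <= expR (\sum_x p x * Phi (fun t => a t + h x t)).
Proof.
move=> hp hPhi hb.
have p0 x : 0 <= p x by case: hp.
pose s2 t := \sum_y p y * h y t ^+ 2.
pose g x t := h x t - 7 / 5 * h x t ^+ 2 - 7 / 5 * s2 t.
pose G x := (fun t => a t + g x t).
pose f x := Phi (G x).
change (\sum_x p x * expR (f x) <= expR (\sum_x p x * Phi (fun t => a t + h x t))).
have [w hw] : exists w : A -> T -> R, forall x, pmf (w x) /\
    forall b, Phi (G x) + \sum_t w x t * (b t - G x t) <= Phi b.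
  by have /choice[w hw] : forall x, exists w : T -> R, pmf w /\
       forall b, Phi (G x) + \sum_t w t * (b t - G x t) <= Phi b;
     [move=> x; have [w w1 w2] := hPhi (G x); exists w | exists w].
have w0 x t : 0 <= w x t by have [[? _] _] := hw x.
pose Q x := \sum_t w x t * (h x t ^+ 2 + s2 t).
have fS x : f x + 7 / 5 * Q x <= Phi (fun t => a t + h x t).
  have [_ /(_ (fun t => a t + h x t))] := hw x.
  congr (_ + _ <= _); rewrite /Q mulr_sumr; apply: eq_bigr => t _.
  by rewrite /G /g; ring.
have fd x y : f x - f y <= 51 / 50 * \sum_t w x t * (`|h x t| + `|h y t|).
  have [_ /(_ (G y))] := hw x.
  rewrite -/(f x) -/(f y) mulr_sumr => hxy.
  apply: (@le_trans _ _ (- \sum_t w x t * (G y t - G x t))); first lra.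
  rewrite -sumrN; apply: ler_sum => t _.
  rewrite -mulrN [leRHS]mulrCA ler_wpM2l // /G /g.
  (* The mean squares [s2] cancel in the difference, and [7/5 v^2 <= 7/400 |v|] fits into the factor
     [51/50]. *)
  have := hb x t; have := hb y t.
  set u := h x t; set v := h y t => hv hu.
  have hV : v ^+ 2 <= `|v| / 80.
    rewrite -(real_normK (num_real v)) expr2 ler_wpM2l //; lra.
  have := ler_norm u; have := ler_norm (- v); rewrite normrN.
  have := sqr_ge0 u; have := normr_ge0 u; have := normr_ge0 v; lra.
have osc x y : f x - f y <= 1 / 19.
  apply: le_trans (fd x y) _.
  apply: (@le_trans _ _ (51 / 50 * (1 / 40))); last lra.
  rewrite ler_pM2l; last lra.
  have [hwx _] := hw x.
  apply: (@le_trans _ _ (\sum_t w x t * (1 / 40))).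
    apply: ler_sum => t _; rewrite ler_wpM2l //.
    have := hb x t; have := hb y t; lra.
  by rewrite pmf_sum_const //; lra.
pose q x y := (51 / 50) ^+ 2 * \sum_t w x t * (2 * (h x t ^+ 2 + h y t ^+ 2)).
have hq x y : f y <= f x -> (f x - f y) ^+ 2 <= q x y.
  move=> fxy; rewrite /q.
  apply: (@le_trans _ _ ((51 / 50 * \sum_t w x t * (`|h x t| + `|h y t|)) ^+ 2)).
    have := fd x y; rewrite -subr_ge0 in fxy => fdxy.
    by rewrite lerXn2r // nnegrE // (le_trans fxy).
  rewrite exprMn ler_wpM2l ?sqr_ge0 //.
  have [hwx _] := hw x.
  apply: le_trans (pmf_jensen_sq _ hwx) _.
  apply: ler_sum => t _; rewrite ler_wpM2l //.
  rewrite -(real_normK (num_real (h x t))) -(real_normK (num_real (h y t))).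
  have := sqr_ge0 (`|h x t| - `|h y t|).
  by rewrite -subr_ge0 => ?; lra.
have hV : \sum_x p x * (f x - \sum_y p y * f y) ^+ 2 <=
    \sum_x p x * (2 * (51 / 50) ^+ 2 * Q x).
  apply: (pmf_var_le hp _ hq).
    move=> x y; rewrite mulr_ge0 ?sqr_ge0 // sumr_ge0 // => t _.
    by rewrite !mulr_ge0 // addr_ge0 ?sqr_ge0.
  move=> x; rewrite le_eqVlt; apply/orP; left; apply/eqP.
  rewrite /q /Q; under eq_bigr do rewrite mulrCA.
  rewrite -mulr_sumr -mulrA mulrCA; congr (_ * _).
  under eq_bigr do rewrite mulr_sumr.
  rewrite exchange_big mulr_sumr; apply: eq_bigr => t _ /=.
  transitivity (\sum_y p y * (2 * w x t * h x t ^+ 2)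
                + 2 * w x t * \sum_y p y * h y t ^+ 2).
    by rewrite mulr_sumr -big_split; apply: eq_bigr => y _ /=; ring.
  by rewrite pmf_sum_const // -/(s2 t); ring.
apply: le_trans (pmf_exp_le hp erefl osc hV) _.
rewrite ler_expR mulr_sumr -big_split; apply: ler_sum => x _ /=.
have -> : p x * f x + 13 / 20 * (p x * (2 * (51 / 50) ^+ 2 * Q x)) =
  p x * (f x + 13 / 10 * (51 / 50) ^+ 2 * Q x) by field.
apply: ler_wpM2l => //; apply: le_trans (fS x).
have Q0 : 0 <= Q x.
  apply: sumr_ge0 => t _; rewrite mulr_ge0 // addr_ge0 ?sqr_ge0 //.
  by apply: sumr_ge0 => y _; rewrite mulr_ge0 ?sqr_ge0.
rewrite lerD2l ler_wpM2r //; lra.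
Qed.


(* Expectation of [Phi (a + sum_i f_i(x_i))], the [x_i] being independent with
   distributions [p i] for [i] in [l]. *)
Fixpoint iexp (I : Type) (A : finType) (T : Type) (p : I -> A -> R)
    (f : I -> A -> T -> R) (l : seq I) (Phi : (T -> R) -> R) (a : T -> R) : R :=
  if l is i :: l' then
    \sum_x p i x * iexp p f l' Phi (fun t => a t + f i x t)
  else Phi a.

Lemma subaff_iexp (I : Type) (A T : finType) (p : I -> A -> R)
    (f : I -> A -> T -> R) (l : seq I) (Phi : (T -> R) -> R) :
  (forall i, pmf (p i)) -> subaff Phi -> subaff (iexp p f l Phi).
Proof.
move=> hp hPhi; elim: l => [//|i l IH] a /=.
have [w hw] : exists w : A -> T -> R, forall x, pmf (w x) /\
    forall b, iexp p f l Phi (fun t => a t + f i x t)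
      + \sum_t w x t * (b t - (a t + f i x t)) <= iexp p f l Phi b.
  have /choice[w w12] : forall x, exists w : T -> R, pmf w /\
    forall b, iexp p f l Phi (fun t => a t + f i x t)
      + \sum_t w t * (b t - (a t + f i x t)) <= iexp p f l Phi b.
    by move=> x; have [w w1 w2] := IH (fun t => a t + f i x t); exists w.
  by exists w.
have p0 x : 0 <= p i x by case: (hp i).
exists (fun t => \sum_x p i x * w x t).
  split=> [t|].
    by apply: sumr_ge0 => x _; rewrite mulr_ge0 //; have [[]] := hw x.
  rewrite exchange_big /= -(hp i).2; apply: eq_bigr => x _.
  by rewrite -mulr_sumr; have [[_ ->] _] := hw x; rewrite mulr1.
move=> b.
apply: (@le_trans _ _ (\sum_x p i x * (iexp p f l Phi (fun t => a t + f i x t)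
      + \sum_t w x t * ((b t + f i x t) - (a t + f i x t))))).
  rewrite le_eqVlt; apply/orP; left; apply/eqP.
  under [RHS]eq_bigr do rewrite mulrDr mulr_sumr.
  rewrite big_split /=; congr (_ + _).
  rewrite exchange_big /=; apply: eq_bigr => t _.
  by rewrite mulr_suml; apply: eq_bigr => x _; ring.
by apply: ler_sum => x _; rewrite ler_wpM2l //; have [_] := hw x.
Qed.

(** By induction the tail of the list is averaged inside the exponential. This average is again
    [subaff], so [subaff_exp_step] applies to it at the head coordinate. *)
Lemma iexp_exp_le (I : Type) (A T : finType) (p : I -> A -> R)
    (h : I -> A -> T -> R) (l : seq I) (Phi : (T -> R) -> R) (a : T -> R) :
  (forall i, pmf (p i)) -> subaff Phi -> (forall i x t, `|h i x t| <= 1 / 80) ->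
  iexp p (fun i x t => h i x t - 7 / 5 * h i x t ^+ 2
                       - 7 / 5 * \sum_y p i y * h i y t ^+ 2) l
    (fun b => expR (Phi b)) a
  <= expR (iexp p h l Phi a).
Proof.
move=> hp hPhi hb; elim: l a => [//|i l IH] a /=.
apply: le_trans (subaff_exp_step a (hp i) (subaff_iexp h l hp hPhi) (hb i)).
by apply: ler_sum => x _; rewrite ler_wpM2l //; case: (hp i).
Qed.

End ExponentialInequality.

(** * Symmetrization, contraction and comparison of iterated expectations *)

Section Contraction.
Context {R : realType}.

(** Jensen's inequality: averaging the affine minorant at the barycentre [a] kills its linear
    part. *)
Lemma subaff_jensen (T A : finType) (p : A -> R) (Phi : (T -> R) -> R)
    (c : A -> T -> R) (a : T -> R) :
  pmf p -> subaff Phi -> (forall t, a t = \sum_x p x * c x t) ->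
  Phi a <= \sum_x p x * Phi (c x).
Proof.
move=> hp hPhi ha; have [w [w0 _] hw] := hPhi a.
apply: (@le_trans _ _ (\sum_x p x * (Phi a + \sum_t w t * (c x t - a t)))).
  under [leRHS]eq_bigr do rewrite mulrDr.
  rewrite big_split /= pmf_sum_const // lerDl.
  under eq_bigr do rewrite mulr_sumr.
  rewrite exchange_big /= big1 // => t _.
  under eq_bigr do rewrite mulrCA.
  rewrite -mulr_sumr; under eq_bigr do rewrite mulrBr.
  by rewrite sumrB pmf_sum_const // -ha subrr mulr0.
by apply: ler_sum => x _; rewrite ler_wpM2l //; case: hp.
Qed.

Lemma pmf_sum_prod_add (A : finType) (p F G : A -> R) : pmf p ->
  \sum_x p x * (\sum_y p y * (F x + G y)) =
  \sum_x p x * F x + \sum_y p y * G y.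
Proof.
move=> hp; set g := \sum_y p y * G y.
transitivity (\sum_x p x * (F x + g)).
  apply: eq_bigr => x _; congr (_ * _).
  transitivity (\sum_y (p y * F x + p y * G y)).
    by apply: eq_bigr => y _; rewrite mulrDr.
  by rewrite big_split /= pmf_sum_const.
transitivity (\sum_x (p x * F x + p x * g)).
  by apply: eq_bigr => x _; rewrite mulrDr.
by rewrite big_split /= pmf_sum_const.
Qed.

(** The contraction principle for a single Rademacher sign. Asking for it at every offset [a] makes
    it stable under averaging over further coordinates. *)
Definition contractive (T : Type) (Phi : (T -> R) -> R) :=
  forall a v v', (forall s t, `|v s - v t| <= `|v' s - v' t|) ->
  Phi (fun t => a t + v t) + Phi (fun t => a t - v t) <=
  Phi (fun t => a t + v' t) + Phi (fun t => a t - v' t).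

(** If [s] and [r] are the two maximizers on the left, the left-hand side is at most
    [a s + a r + |v' s - v' r|]. According to the sign of [v' s - v' r], the two maxima on the right
    are tested at [s], [r] or at [r], [s]. *)
Lemma contractive_maxf (T : finType) (t0 : T) : contractive (maxf (R:=R) t0).
Proof.
move=> a v v' hv.
set s := [arg max_(t > t0) (a t + v t)]%O.
set r := [arg max_(t > t0) (a t - v t)]%O.
have -> : maxf t0 (fun t => a t + v t) = a s + v s by [].
have -> : maxf t0 (fun t => a t - v t) = a r - v r by [].
have := maxf_ge t0 (fun t => a t + v' t) s.
have := maxf_ge t0 (fun t => a t + v' t) r.
have := maxf_ge t0 (fun t => a t - v' t) s.
have := maxf_ge t0 (fun t => a t - v' t) r.
have := le_trans (ler_norm _) (hv s r).
by rewrite ler_normr => /orP[]; lra.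
Qed.

Lemma contractive_iexp (I : Type) (A T : finType) (p : I -> A -> R)
    (f : I -> A -> T -> R) (l : seq I) (Phi : (T -> R) -> R) :
  (forall i, pmf (p i)) -> contractive Phi -> contractive (iexp p f l Phi).
Proof.
move=> hp hPhi; elim: l => [//|i l IH] a v v' hv /=.
rewrite -!big_split; apply: ler_sum => x _ /=.
rewrite -!mulrDr ler_wpM2l //; first by case: (hp i).
have := IH (fun t => a t + f i x t) v v' hv.
have e w : (fun t => a t + f i x t + w t) = (fun t => a t + w t + f i x t).
  by apply/funext => t; ring.
have e' w : (fun t => a t + f i x t - w t) = (fun t => a t - w t + f i x t).
  by apply/funext => t; ring.
by rewrite (e v) (e v') (e' v) (e' v').
Qed.

(** Comparison of iterated expectations driven by the same coordinates. The relation between the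
    accumulated functions may depend on the coordinates still to come, so that a variance budget can
    be spent along the list. *)
Lemma iexp_rel (I : Type) (A T T' : finType) (p : I -> A -> R)
    (f : I -> A -> T -> R) (g : I -> A -> T' -> R)
    (Rel : seq I -> (T -> R) -> (T' -> R) -> Prop)
    (Phi : (T -> R) -> R) (Psi : (T' -> R) -> R) l a b :
  (forall i, pmf (p i)) ->
  (forall i l x a b, Rel (i :: l) a b ->
     Rel l (fun t => a t + f i x t) (fun t => b t + g i x t)) ->
  (forall a b, Rel [::] a b -> Phi a <= Psi b) ->
  Rel l a b -> iexp p f l Phi a <= iexp p g l Psi b.
Proof.
move=> hp hstep hend; elim: l a b => [|i l IH] a b hR /=; first exact: hend.
apply: ler_sum => x _; rewrite ler_wpM2l //; first by case: (hp i).
exact/IH/hstep.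
Qed.

Lemma iexp_rel3 (I : Type) (A T T1 T2 : finType) (p : I -> A -> R)
    (f : I -> A -> T -> R) (g1 : I -> A -> T1 -> R) (g2 : I -> A -> T2 -> R)
    (Rel : seq I -> (T -> R) -> (T1 -> R) -> (T2 -> R) -> Prop)
    (Phi : (T -> R) -> R) (Psi1 : (T1 -> R) -> R) (Psi2 : (T2 -> R) -> R)
    l a b c :
  (forall i, pmf (p i)) ->
  (forall i l x a b c, Rel (i :: l) a b c ->
     Rel l (fun t => a t + f i x t) (fun t => b t + g1 i x t)
       (fun t => c t + g2 i x t)) ->
  (forall a b c, Rel [::] a b c -> Phi a <= Psi1 b + Psi2 c) ->
  Rel l a b c ->
  iexp p f l Phi a <= iexp p g1 l Psi1 b + iexp p g2 l Psi2 c.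
Proof.
move=> hp hstep hend; elim: l a b c => [|i l IH] a b c hR /=; first exact: hend.
rewrite -big_split; apply: ler_sum => x _ /=.
rewrite -mulrDr ler_wpM2l //; first by case: (hp i).
exact/IH/hstep.
Qed.

Lemma iexp_affine (I : Type) (A T : finType) (p : I -> A -> R)
    (f : I -> A -> T -> R) (Phi : (T -> R) -> R) (k m : R) l a :
  (forall i, pmf (p i)) ->
  iexp p f l (fun b => k * Phi b + m) a = k * iexp p f l Phi a + m.
Proof.
move=> hp; elim: l a => [//|i l IH] a /=.
under eq_bigr do rewrite IH mulrDr mulrCA.
by rewrite big_split /= pmf_sum_const // mulr_sumr.
Qed.

Definition pair_pmf (A : finType) (p : A -> R) (z : A * A) : R := p z.1 * p z.2.

Lemma pmf_pair (A : finType) (p : A -> R) : pmf p -> pmf (pair_pmf p).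
Proof.
move=> hp; split=> [z|]; first by rewrite mulr_ge0 //; case: hp.
rewrite -(pair_bigA _ (fun x y => p x * p y)) /= -hp.2.
by apply: eq_bigr => x _; rewrite -mulr_sumr hp.2 mulr1.
Qed.

Lemma sum_pair_pmf (A : finType) (p : A -> R) (F : A -> A -> R) :
  \sum_z pair_pmf p z * F z.1 z.2 = \sum_x p x * \sum_y p y * F x y.
Proof.
rewrite -(pair_bigA _ (fun x y => p x * p y * F x y)) /=.
by apply: eq_bigr => x _; rewrite mulr_sumr; apply: eq_bigr => y _; rewrite mulrA.
Qed.

(** Decoupling: once the final value over pairs is bounded by a sum of one term per component, each
    component can be averaged on its own. *)
Lemma iexp_pair_le (I : Type) (A T T' : finType) (p : I -> A -> R)
    (f : I -> A -> T -> R) (g : I -> A * A -> T' -> R)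
    (Rel : (T' -> R) -> (T -> R) -> (T -> R) -> Prop)
    (Phi : (T' -> R) -> R) (Psi : (T -> R) -> R) l a b c :
  (forall i, pmf (p i)) ->
  (forall i x y a b c, Rel a b c ->
     Rel (fun t => a t + g i (x, y) t) (fun t => b t + f i x t)
         (fun t => c t + f i y t)) ->
  (forall a b c, Rel a b c -> Phi a <= Psi b + Psi c) ->
  Rel a b c ->
  iexp (fun i => pair_pmf (p i)) g l Phi a <=
  iexp p f l Psi b + iexp p f l Psi c.
Proof.
move=> hp hstep hend; elim: l a b c => [|i l IH] a b c hR /=; first exact: hend.
have p0 x : 0 <= p i x by case: (hp i).
apply: (@le_trans _ _ (\sum_z pair_pmf (p i) z *
    (iexp p f l Psi (fun t => b t + f i z.1 t) +
     iexp p f l Psi (fun t => c t + f i z.2 t)))).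
  apply: ler_sum => -[x y] _; rewrite ler_wpM2l ?mulr_ge0 //.
  exact/IH/hstep.
rewrite (sum_pair_pmf _ (fun x y => iexp p f l Psi (fun t => b t + f i x t) +
     iexp p f l Psi (fun t => c t + f i y t))).
by rewrite pmf_sum_prod_add.
Qed.

(** Replacement one coordinate at a time: when a coordinate is exchanged, all later ones already
    have their new distribution. *)
Lemma iexp_repl (I : Type) (A A' T : finType) (p : I -> A -> R)
    (p' : I -> A' -> R) (f : I -> A -> T -> R) (f' : I -> A' -> T -> R)
    (Phi : (T -> R) -> R) l a :
  (forall i, pmf (p i)) ->
  (forall i l a,
    \sum_x p i x * iexp p' f' l Phi (fun t => a t + f i x t) <=
    \sum_x p' i x * iexp p' f' l Phi (fun t => a t + f' i x t)) ->
  iexp p f l Phi a <= iexp p' f' l Phi a.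
Proof.
move=> hp hstep; elim: l a => [//|i l IH] a /=.
apply: le_trans (hstep i l a).
by apply: ler_sum => x _; rewrite ler_wpM2l //; case: (hp i).
Qed.

(* Symmetrization, contraction and desymmetrization of one coordinate. *)
Lemma square_step (A T : finType) (p : A -> R) (u : A -> T -> R)
    (b : R) (Phi : (T -> R) -> R) a :
  pmf p -> subaff Phi -> contractive Phi ->
  (forall t, \sum_x p x * u x t = 0) -> (forall x t, `|u x t| <= b) ->
  \sum_x p x * Phi (fun t => a t + (u x t ^+ 2 - \sum_y p y * u y t ^+ 2)) <=
  \sum_z pair_pmf p z * Phi (fun t => a t + 4 * b * (u z.1 t - u z.2 t)).
Proof.
move=> hp hPhi hC u0 ub; have p0 x : 0 <= p x by case: hp.
rewrite (sum_pair_pmf _ (fun x y => Phi (fun t => a t + 4 * b * (u x t - u y t)))).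
have half2 (r : R) : r = (r + r) / 2 by field.
have conv c d e : (forall t, c t = (d t + e t) / 2) -> Phi c <= (Phi d + Phi e) / 2.
  move=> hc.
  have hq : pmf (fun _ : bool => 1 / 2 : R).
    by split=> [_|]; [lra | rewrite big_bool /=; lra].
  have := @subaff_jensen T bool _ Phi (fun s => if s then d else e) c hq hPhi.
  rewrite big_bool /= => /(_ _)/le_trans; apply; last lra.
  by move=> t; rewrite hc big_bool /=; lra.
(* Jensen with an independent copy turns the centred square into [u x t ^+ 2 - u y t ^+ 2], the
   midpoint of [2 * u x t ^+ 2] and [- 2 * u y t ^+ 2]; convexity then leaves a symmetric sign in
   front of [2 * u x t ^+ 2]. *)
pose P2 x := (Phi (fun t => a t + 2 * u x t ^+ 2)
              + Phi (fun t => a t - 2 * u x t ^+ 2)) / 2.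
apply: (@le_trans _ _ (\sum_x p x * P2 x)).
  apply: (@le_trans _ _ (\sum_x p x * \sum_y p y *
      Phi (fun t => a t + (u x t ^+ 2 - u y t ^+ 2)))).
    apply: ler_sum => x _; rewrite ler_wpM2l //.
    apply: subaff_jensen => // t.
    under [RHS]eq_bigr do rewrite addrA mulrBr.
    by rewrite sumrB pmf_sum_const // addrA.
  apply: (@le_trans _ _ (\sum_x p x * \sum_y p y *
      (Phi (fun t => a t + 2 * u x t ^+ 2) / 2 +
       Phi (fun t => a t - 2 * u y t ^+ 2) / 2))).
    apply: ler_sum => x _; rewrite ler_wpM2l //.
    apply: ler_sum => y _; rewrite ler_wpM2l // -mulrDl.
    by apply: conv => t; field.
  rewrite pmf_sum_prod_add // -big_split.
  by apply: ler_sum => x _ /=; rewrite -mulrDr -mulrDl.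
pose P3 x := (Phi (fun t => a t + 4 * b * u x t)
              + Phi (fun t => a t - 4 * b * u x t)) / 2.
apply: (@le_trans _ _ (\sum_x p x * P3 x)).
  apply: ler_sum => x _; rewrite ler_wpM2l // ler_pM2r; last lra.
  (* Contraction: [r -> 2 r^2] is Lipschitz with constant [4 b] on [[-b, b]]. *)
  apply: hC => s t.
  have -> : 2 * u x s ^+ 2 - 2 * u x t ^+ 2 = 2 * (u x s + u x t) * (u x s - u x t).
    by ring.
  rewrite -mulrBr !normrM; apply: ler_wpM2r => //.
  have b0 : 0 <= b := le_trans (normr_ge0 _) (ub x s).
  rewrite (ger0_norm (x := 2)) // (ger0_norm b0) (ger0_norm (x := 4)) //.
  have := ler_normD (u x s) (u x t); have := ub x s; have := ub x t; lra.
(* Desymmetrization: a centred independent copy is introduced by Jensen, with either sign. *)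
have side1 x : Phi (fun t => a t + 4 * b * u x t) <=
    \sum_y p y * Phi (fun t => a t + 4 * b * (u x t - u y t)).
  apply: subaff_jensen => // t.
  transitivity (\sum_y p y * (a t + 4 * b * u x t)
                - 4 * b * \sum_y p y * u y t).
    by rewrite u0 pmf_sum_const // mulr0 subr0.
  by rewrite mulr_sumr -sumrB; apply: eq_bigr => y _; ring.
have side2 y : Phi (fun t => a t - 4 * b * u y t) <=
    \sum_x p x * Phi (fun t => a t + 4 * b * (u x t - u y t)).
  apply: subaff_jensen => // t.
  transitivity (\sum_x p x * (a t - 4 * b * u y t)
                + 4 * b * \sum_x p x * u x t).
    by rewrite u0 pmf_sum_const // mulr0 addr0.
  by rewrite mulr_sumr -big_split; apply: eq_bigr => x _ /=; ring.
set E := (X in _ <= X).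
have s1 : \sum_x p x * Phi (fun t => a t + 4 * b * u x t) <= E.
  by apply: ler_sum => x _; rewrite ler_wpM2l.
have s2 : \sum_x p x * Phi (fun t => a t - 4 * b * u x t) <= E.
  have -> : E = \sum_y p y * \sum_x p x * Phi (fun t => a t + 4 * b * (u x t - u y t)).
    rewrite /E; under eq_bigr do rewrite mulr_sumr.
    rewrite exchange_big /=; apply: eq_bigr => x _.
    by rewrite mulr_sumr; apply: eq_bigr => y _; rewrite mulrCA.
  by apply: ler_sum => x _; rewrite ler_wpM2l.
have -> : \sum_x p x * P3 x = (\sum_x p x * Phi (fun t => a t + 4 * b * u x t)
    + \sum_x p x * Phi (fun t => a t - 4 * b * u x t)) / 2.
  rewrite -big_split mulr_suml; apply: eq_bigr => x _ /=.
  by rewrite /P3 -mulrDr mulrA.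
lra.
Qed.

End Contraction.

(** * A Talagrand-type inequality for finite alphabets and finitely many functions *)

Section FiniteConcentration.
Context {R : realType}.

(* The sign turns [maxabs] over [T] into a plain maximum over [T * bool]. *)
Definition flip (T : Type) (a : T -> R) (ts : T * bool) : R :=
  (-1) ^+ ts.2 * a ts.1.

Definition maxabs (T : finType) (t0 : T) (a : T -> R) : R :=
  maxf t0 (fun t => `|a t|).

Lemma flip_le_maxabs (T : finType) (t0 : T) (a : T -> R) ts :
  flip a ts <= maxabs t0 a.
Proof.
apply: le_trans (maxf_ge t0 (fun t => `|a t|) ts.1).
by apply: le_trans (ler_norm _) _; rewrite /flip normrM normr_sign mul1r.
Qed.

Lemma maxf_le (T : finType) (t0 : T) (a : T -> R) c :
  (forall t, a t <= c) -> maxf t0 a <= c.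
Proof. by move=> /(_ _); apply. Qed.

Lemma maxabs_flip (T : finType) (t0 : T) (a : T -> R) (b : T * bool -> R) :
  (forall ts, flip a ts <= b ts) -> maxabs t0 a <= maxf (t0, false) b.
Proof.
move=> h; apply: maxf_le => t.
rewrite ler_norml; apply/andP; split.
  have := h (t, true); have := maxf_ge (t0, false) b (t, true).
  by rewrite /flip /= expr1; lra.
have := h (t, false); have := maxf_ge (t0, false) b (t, false).
by rewrite /flip /= expr0; lra.
Qed.

Lemma maxabs_ge0 (T : finType) (t0 : T) (a : T -> R) : 0 <= maxabs t0 a.
Proof. by apply: le_trans (maxf_ge t0 _ t0). Qed.

Section Bound.
Context (I : eqType) (A T : finType) (t0 : T) (p : I -> A -> R)
  (u : I -> A -> T -> R) (l : seq I) (v2 : R).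
Hypothesis hp : forall i, pmf (p i).
Hypothesis u0 : forall i t, \sum_x p i x * u i x t = 0.
Hypothesis ub : forall i x t, `|u i x t| <= 2.
Hypothesis uv : forall t, \sum_(i <- l) \sum_x p i x * u i x t ^+ 2 <= v2.

Let EN := iexp p u l (maxabs t0) (fun=> 0).
Let M := maxf (R := R) (t0, false).
Let ud i x ts := flip (u i x) ts.
Let s2 i (ts : T * bool) := \sum_x p i x * ud i x ts ^+ 2.

Lemma flip_sq (a : T -> R) ts : flip a ts ^+ 2 = a ts.1 ^+ 2.
Proof. by rewrite /flip exprMn sqrr_sign mul1r. Qed.

Let s2_le ts : \sum_(i <- l) s2 i ts <= v2.
Proof.
apply: le_trans (uv ts.1); apply: ler_sum => i _; apply: ler_sum => x _.
by rewrite /ud flip_sq.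
Qed.

(** [square_step] with [b = 2] on every coordinate leaves [8] times the difference of two
    independent copies of the process. Its maximum is at most [8] times the sum of the two maximal
    absolute values, each of mean [EN]. *)
Lemma centered_squares_le :
  iexp p (fun i x ts => ud i x ts ^+ 2 - s2 i ts) l M (fun=> 0) <= 16 * EN.
Proof.
apply: (@le_trans _ _ (iexp (fun i => pair_pmf (p i))
   (fun i z ts => 4 * 2 * (ud i z.1 ts - ud i z.2 ts)) l M (fun=> 0))).
  apply: iexp_repl => // i l' a.
  apply: square_step => //.
  - apply: subaff_iexp; first by move=> j; exact: pmf_pair.
    exact: subaff_maxf.
  - apply: contractive_iexp; first by move=> j; exact: pmf_pair.
    exact: contractive_maxf.
  - move=> [t s]; rewrite /ud /flip /=.
    by under eq_bigr do rewrite mulrCA; rewrite -mulr_sumr u0 mulr0.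
  - by move=> x [t s]; rewrite /ud /flip normrM normr_sign mul1r.
have -> : 16 * EN = (8 * EN + 0) + (8 * EN + 0) by ring.
rewrite /EN -iexp_affine //.
apply: (@iexp_pair_le R _ _ _ _ _ _ _ (fun a b c => forall ts,
    a ts = 8 * (flip b ts - flip c ts))) => //.
- move=> i x y a b c h ts /=; rewrite h /ud /flip; ring.
- move=> a b c h; apply: maxf_le => ts; rewrite h.
  have := flip_le_maxabs t0 b ts.
  have := flip_le_maxabs t0 c (ts.1, ~~ ts.2).
  by rewrite /flip /=; case: ts => t [] /=; rewrite ?expr0 ?expr1; lra.
- by move=> ts; rewrite /flip; ring.
Qed.

Context (lam : R).
Hypothesis lamE : lam = 1 / 300.
(* As [|lam ud|] is tiny, [h - 7/5 h^2 >= lam ud]. *)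
Let h i x ts := lam * ud i x ts + 3 / 2 * lam ^+ 2 * ud i x ts ^+ 2.

(** [h] is [lam ud], plus [3/2 lam^2] times a centred square, plus [3/2 lam^2] times its mean. With
    [centered_squares_le] the factor of [EN] is [lam (1 + 16 * 3/2 * lam)], and
    [1 + 24/300 = 27/25]. *)
Lemma quadratic_mean_le :
  iexp p h l M (fun=> 0) <= lam * (27 / 25 * EN) + 3 / 2 * lam ^+ 2 * v2.
Proof.
apply: (@le_trans _ _ ((lam * EN + 0) + (3 / 2 * lam ^+ 2 *
   iexp p (fun i x ts => ud i x ts ^+ 2 - s2 i ts) l M (fun=> 0)
   + 3 / 2 * lam ^+ 2 * v2))).
  rewrite /EN -!iexp_affine //.
  (* [v2] minus the variances of the remaining coordinates is the part of the budget available for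
     the means of the squares already met. *)
  pose Rel l' (a : T * bool -> R) (b : T -> R) (c : T * bool -> R) := forall ts,
    a ts <= lam * flip b ts + 3 / 2 * lam ^+ 2 *
      (c ts + (v2 - \sum_(i <- l') s2 i ts)).
  apply: (@iexp_rel3 R _ _ _ _ _ _ _ _ _ Rel) => //.
  - move=> i l' x a b c hR ts /=; have := hR ts.
    rewrite big_cons /h /ud /flip /= !mulrDr; lra.
  - move=> a b c hR; apply: maxf_le => ts; apply: le_trans (hR ts) _.
    rewrite big_nil subr0 addr0 mulrDr !addrA lerD2r lerD //.
      by rewrite ler_wpM2l ?flip_le_maxabs // lamE; lra.
    by rewrite ler_wpM2l ?maxf_ge // mulr_ge0 ?sqr_ge0 //; lra.
  - move=> ts; rewrite /flip mulr0 mulr0 add0r add0r mulr_ge0 //.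
      by rewrite mulr_ge0 ?sqr_ge0 //; lra.
    by rewrite subr_ge0.
have := centered_squares_le.
rewrite lamE; lra.
Qed.

(** The signed maximum of [lam ud] is compared with the compensated exponent of [iexp_exp_le], at
    the price [c * v2]; [quadratic_mean_le] bounds the resulting mean. The factor of [v2] is [lam]
    times [(3/2 + 7/5 (101/100)^2) / 300], which is below [1/100]. *)
Lemma finite_concentration :
  iexp p u l (fun a => expR (lam * maxabs t0 a)) (fun=> 0) <=
  expR (lam * (27 / 25 * EN + 1 / 100 * v2)).
Proof.
have udb i x ts : `|ud i x ts| <= 2 by rewrite /ud /flip normrM normr_sign mul1r.
have hu i x ts : `|h i x ts| <= 101 / 100 * lam * `|ud i x ts|.
  rewrite /h; set w := ud i x ts; have := udb i x ts; rewrite -/w => wb.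
  have -> : lam * w + 3 / 2 * lam ^+ 2 * w ^+ 2 = (1 + 3 / 2 * lam * w) * lam * w.
    by ring.
  rewrite normrM ler_wpM2r // normrM (ger0_norm (x := lam)); last by rewrite lamE; lra.
  rewrite ler_wpM2r //; first by rewrite lamE; lra.
  by move: wb; rewrite !ler_norml lamE; lra.
have hb i x ts : `|h i x ts| <= 1 / 80.
  apply: le_trans (hu i x ts) _; have := udb i x ts; rewrite lamE; lra.
have hsq i x ts : h i x ts ^+ 2 <= (101 / 100 * lam) ^+ 2 * ud i x ts ^+ 2.
  have := hu i x ts.
  rewrite -(real_normK (num_real (h i x ts))) -(real_normK (num_real (ud i x ts))).
  by move=> ?; rewrite -exprMn lerXn2r // nnegrE // !mulr_ge0 // lamE; lra.
pose c := 7 / 5 * (101 / 100 * lam) ^+ 2.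
have c0 : 0 <= c by rewrite /c mulr_ge0 ?sqr_ge0 //; lra.
have hp0 i x : 0 <= p i x by case: (hp i).
(* The added [3/2 lam^2 ud^2] absorbs [7/5 h^2], as [7/5 (101/100)^2 < 3/2]; the subtracted mean
   square is returned by [c * s2]. *)
have step i x ts : lam * ud i x ts <= h i x ts - 7 / 5 * h i x ts ^+ 2
    - 7 / 5 * (\sum_y p i y * h i y ts ^+ 2) + c * s2 i ts.
  have h2 : \sum_y p i y * h i y ts ^+ 2 <= (101 / 100 * lam) ^+ 2 * s2 i ts.
    rewrite /s2 mulr_sumr; apply: ler_sum => y _.
    by rewrite [leRHS]mulrCA ler_wpM2l ?hp0 ?hsq.
  have h3 := hsq i x ts.
  have h4 := sqr_ge0 (ud i x ts).
  rewrite {1}/h; move: h2 h3 h4; rewrite /c lamE; lra.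
have main : iexp p u l (fun a => expR (lam * maxabs t0 a)) (fun=> 0) <=
    expR (c * v2) * expR (iexp p h l M (fun=> 0)).
  apply: (@le_trans _ _ (expR (c * v2) * iexp p (fun i x ts => h i x ts
      - 7 / 5 * h i x ts ^+ 2 - 7 / 5 * \sum_y p i y * h i y ts ^+ 2) l
      (fun b => expR (M b)) (fun=> 0))); last first.
    rewrite ler_wpM2l ?expR_ge0 //.
    exact: (iexp_exp_le _ _ hp (subaff_maxf _) hb).
  rewrite -[leRHS]addr0 -iexp_affine //.
  pose Rel l' (a : T -> R) (b : T * bool -> R) := forall ts,
    lam * flip a ts <= b ts + c * (v2 - \sum_(i <- l') s2 i ts).
  apply: (@iexp_rel R _ _ _ _ _ _ _ Rel) => //.
  - move=> i l' x a b hR ts /=; have := hR ts; have := step i x ts.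
    rewrite big_cons /ud /flip /=; lra.
  - move=> a b hR; rewrite addr0 -expRD ler_expR.
    have l0 : 0 < lam by rewrite lamE; lra.
    rewrite mulrC -ler_pdivlMr // /M.
    apply: le_trans (maxabs_flip (b := fun ts => (b ts + c * v2) / lam) t0 _) _.
      move=> ts; rewrite ler_pdivlMr // mulrC; have := hR ts.
      by rewrite big_nil subr0.
    apply: maxf_le => ts; rewrite ler_pM2r ?invr_gt0 // addrC lerD2l.
    exact: maxf_ge.
  - move=> ts; rewrite /flip mulr0 mulr0 add0r mulr_ge0 //.
    by rewrite subr_ge0.
apply: le_trans main _; rewrite -expRD ler_expR.
have := quadratic_mean_le.
have v20 : 0 <= v2.
  by apply: le_trans (uv t0); rewrite !sumr_ge0 // => i _; rewrite sumr_ge0 // => x _;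
    rewrite mulr_ge0 ?sqr_ge0.
by rewrite /c lamE; lra.
Qed.

End Bound.

End FiniteConcentration.

(** * From finite alphabets to general observations *)

Section IteratedExpectation.
Context {R : realType}.

(** The constraint [C] is there for the induction: the value [z] of the head coordinate is frozen by
    shrinking [C i] to the single letter [z], while the coordinates still in [l] stay free. *)
Lemma iexp_family (I A T : finType) (p : I -> A -> R) (f : I -> A -> T -> R)
    (Phi : (T -> R) -> R) (l : seq I) (C : I -> pred A) (a : T -> R) :
  (forall i, pmf (p i)) -> uniq l -> (forall i, i \in l -> C i =1 predT) ->
  \sum_(x : {ffun I -> A} | x \in family C) (\prod_i p i (x i)) *
      Phi (fun t => a t + \sum_(i <- l) f i (x i) t)
  = (\prod_i \sum_(z | C i z) p i z) * iexp p f l Phi a.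
Proof.
move=> hp; elim: l C a => [|i l IH] C a /=.
  move=> _ _; under eq_bigr => x _.
    rewrite (_ : (fun t => _) = a); last by apply/funext => t; rewrite big_nil addr0.
    over.
  by rewrite -mulr_suml -bigA_distr_big_dep.
move=> /andP[il ul] hC.
pose C' z j : pred A := if j == i then (fun y => y == z) else C j.
have hC' z j : j \in l -> C' z j =1 predT.
  move=> jl; rewrite /C' ifN; first by apply: hC; rewrite inE jl orbT.
  by apply: contraNneq il => <-.
rewrite (partition_big (fun x : {ffun I -> A} => x i) predT) //= mulr_sumr.
apply: eq_bigr => z _.
transitivity (\sum_(x : {ffun I -> A} | x \in family (C' z))
    (\prod_i p i (x i)) *
    Phi (fun t => a t + f i z t + \sum_(j <- l) f j (x j) t)).
  apply: eq_big => [x|x /andP[_ /eqP xi]]; last first.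
    congr (_ * Phi _); apply/funext => t.
    by rewrite big_cons xi addrA.
  apply/andP/familyP => [[/familyP h /eqP xi] j|h].
    by rewrite /C'; case: eqP => [->|_]; [apply/eqP | exact: h].
  have xi : x i = z by have := h i; rewrite /C' eqxx => /eqP.
  split; last exact/eqP.
  apply/familyP => j; have := h j; rewrite /C'; case: eqP => [-> _|//].
  by rewrite unfold_in; apply: (hC i (mem_head _ _)).
rewrite IH //; last exact: hC'.
rewrite [in RHS]mulrCA; rewrite (bigD1 i) //= (bigD1 i (P := xpredT) (F := fun i => \sum_(z | C i z) p i z)) //=.
have -> : \sum_(z0 | C' z i z0) p i z0 = p i z.
  by rewrite /C' eqxx big_pred1_eq.
have -> : \sum_(z0 | C i z0) p i z0 = 1.
  rewrite -(hp i).2; apply: eq_bigl => y; exact: (hC i (mem_head _ _)).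
rewrite mul1r !mulrA; congr (_ * _ * _).
by apply: eq_bigr => j /negbTE ji; rewrite /C' ji.
Qed.

Lemma iexp_enum (I A T : finType) (p : I -> A -> R) (f : I -> A -> T -> R)
    (Phi : (T -> R) -> R) :
  (forall i, pmf (p i)) ->
  iexp p f (enum I) Phi (fun=> 0) =
  \sum_(x : {ffun I -> A}) (\prod_i p i (x i)) * Phi (fun t => \sum_i f i (x i) t).
Proof.
move=> hp.
have := iexp_family f Phi (C := fun _ => predT) (fun=> 0) hp (enum_uniq I) (fun _ _ _ => erefl).
rewrite [X in _ = X * _](_ : _ = 1) ?mul1r => [<-|]; last first.
  by rewrite big1 // => i _; exact: (hp i).2.
apply: eq_big => [x|x _]; first by rewrite (_ : (x \in family _) = true) //; exact/familyP.
congr (_ * Phi _); apply/funext => t; rewrite add0r.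
by rewrite big_enum.
Qed.

Context d (Omega : measurableType d) (Q : probability Omega R).

Lemma integral_finite_valued (B : finType) (Y : Omega -> B) (G : B -> R) :
  (forall b, measurable (Y @^-1` [set b])) -> (forall b, 0 <= G b) ->
  (\int[Q]_w (G (Y w))%:E)%E = (\sum_b fine (Q (Y @^-1` [set b])) * G b)%:E.
Proof.
move=> mY G0.
transitivity (\int[Q]_w (\sum_(b : B) (G b * \1_(Y @^-1` [set b]) w)%:E))%E.
  apply: eq_integral => w _; rewrite sumEFin (bigD1 (Y w)) //= big1 ?addr0.
    by rewrite indicE mem_set // mulr1.
  move=> b /negP bY; rewrite indicE memNset ?mulr0 //= => e.
  by apply: bY; rewrite e.
rewrite ge0_integral_sum //=.
- rewrite -sumEFin; apply: eq_bigr => b _.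
  under eq_integral do rewrite EFinM.
  rewrite ge0_integralZl //=.
  + rewrite integral_indic // setIT EFinM fineK ?fin_num_measure // muleC //.
  + by apply/measurable_EFinP; exact: measurable_indic.
  + by rewrite lee_fin G0.
- by move=> b; apply/measurable_EFinP; apply: measurable_funM => //; exact: measurable_indic.
- by move=> b w _; rewrite lee_fin mulr_ge0 ?G0.
Qed.

Context (n : nat) (dd : 'I_n -> measure_display)
  (E : forall i, measurableType (dd i)) (X : forall i, Omega -> E i).
Context (A : finType) (q : forall i, E i -> A).

Hypothesis mX : forall i, measurable_fun setT (X i).
Hypothesis hX : independent X Q.
Hypothesis mq : forall i z, measurable (@q i @^-1` [set z]).

Definition value_pmf i z : R := fine (Q (X i @^-1` (@q i @^-1` [set z]))).

Lemma measurable_value i z : measurable (X i @^-1` (@q i @^-1` [set z])).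
Proof. by rewrite -[X in measurable X]setTI; exact: mX. Qed.

Lemma pmf_value i : pmf (value_pmf i).
Proof.
split=> [z|]; first by rewrite /value_pmf fine_ge0.
have := integral_finite_valued (Y := fun w => q (X i w)) (G := fun=> 1)
  (fun z => measurable_value i z) (fun=> ler01).
have -> : (\int[Q]_w 1%:E = 1)%E.
  by rewrite integral_cst // mul1e; exact: probability_setT.
move=> -[->].
by apply: eq_bigr => z _; rewrite mulr1.
Qed.

(** By independence the vector of letters has the product of the [value_pmf] as its law, so the
    integral is a finite sum over [{ffun 'I_n -> A}], which [iexp_enum] identifies. *)
Lemma integral_iexp (T : finType) (f : 'I_n -> A -> T -> R) (Phi : (T -> R) -> R) :
  (forall a, 0 <= Phi a) ->
  (\int[Q]_w (Phi (fun t => \sum_i f i (q (X i w)) t))%:E)%E =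
  (iexp value_pmf f (enum 'I_n) Phi (fun=> 0))%:E.
Proof.
move=> Phi0.
pose Y w : {ffun 'I_n -> A} := [ffun i => q (X i w)].
have eY x : Y @^-1` [set x] =
    \bigcap_(i in [set` [set: 'I_n]%SET]) (X i @^-1` (@q i @^-1` [set x i])).
  apply/seteqP; split=> w /=.
    by move=> <- i _; rewrite ffunE.
  by move=> h; apply/ffunP => i; rewrite ffunE; apply: h => /=; rewrite inE.
rewrite iexp_enum; last exact: pmf_value.
have eQ x : fine (Q (Y @^-1` [set x])) = \prod_i value_pmf i (x i).
  rewrite eY hX //.
  rewrite (eq_bigr (fun i => (value_pmf i (x i))%:E)) => [|i _]; last first.
    by rewrite /value_pmf fineK // fin_num_measure //; exact: measurable_value.
  rewrite prodEFin /=; apply: eq_bigl => i; by rewrite inE.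
transitivity (\sum_(x : {ffun 'I_n -> A}) fine (Q (Y @^-1` [set x])) *
    Phi (fun t => \sum_i f i (x i) t))%:E; last first.
  by congr EFin; apply: eq_bigr => x _; rewrite eQ.
rewrite -(integral_finite_valued (Y := Y)
  (G := fun x => Phi (fun t => \sum_i f i (x i) t))) //; last first.
  move=> x; rewrite eY; apply: fin_bigcap_measurable => // i _.
  exact: measurable_value.
by apply: eq_integral => w _; congr (Phi _)%:E; apply/funext => t;
  apply: eq_bigr => i _; rewrite ffunE.
Qed.

End IteratedExpectation.

(** * Integrability of bounded functions, finite maxima and quantization of [[-1, 1]] *)

Section Discretization.
Context {R : realType}.

Lemma bounded_integrable d (Omega : measurableType d) (Q : probability Omega R)
    (f : Omega -> R) (M : R) :
  measurable_fun setT f -> (forall x, `|f x| <= M) ->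
  Q.-integrable setT (EFin \o f).
Proof.
move=> mf hM; apply: measurable_bounded_integrable => //.
  by rewrite [X in (X < _)%E](@probability_setT _ _ _ Q) ltry.
exists M; split; first exact: num_real.
by move=> x Mx y _; apply: le_trans (hM y) (ltW Mx).
Qed.

Lemma cst_integrable d (Omega : measurableType d) (Q : probability Omega R)
    (c : R) : Q.-integrable setT (EFin \o (fun=> c)).
Proof.
by apply: (@bounded_integrable _ _ _ _ `|c|) => [|w]; [exact: measurable_cst|].
Qed.

Lemma Rintegral_prob_cst d (Omega : measurableType d) (Q : probability Omega R)
    (r : R) : \int[Q]_w r = r.
Proof.
rewrite Rintegral_cst // [X in fine X](@probability_setT _ _ _ Q) /=.
by rewrite mulr1.
Qed.

Lemma measurable_funnorm d (Omega : measurableType d) (f : Omega -> R) :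
  measurable_fun setT f -> measurable_fun setT (fun x => `|f x|).
Proof. by move=> mf; apply: measurableT_comp mf; exact: normr_measurable. Qed.

Lemma maxfE (T : finType) (t0 : T) (a : T -> R) :
  maxf t0 a = \big[Num.max/a t0]_t a t.
Proof.
apply/le_anti/andP; split; first exact: le_bigmax.
by apply: bigmax_le => [|t _]; exact: maxf_ge.
Qed.

Lemma measurable_maxf d (Omega : measurableType d) (T : finType) (t0 : T)
    (f : T -> Omega -> R) :
  (forall t, measurable_fun setT (f t)) ->
  measurable_fun setT (fun w => maxf t0 (fun t => f t w)).
Proof.
move=> mf.
rewrite (_ : (fun w => _) = fun w => \big[Num.max/f t0 w]_t f t w); last first.
  by apply/funext => w; rewrite maxfE.
elim: (index_enum T) => [|t s IH].
  by rewrite (_ : (fun w => _) = f t0) //; apply/funext => w; rewrite big_nil.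
rewrite (_ : (fun w => _) = f t \max (fun w => \big[Num.max/f t0 w]_(t <- s) f t w)).
  exact: measurable_maxr.
by apply/funext => w; rewrite big_cons.
Qed.

Lemma measurable_maxabs d (Omega : measurableType d) (T : finType) (t0 : T)
    (f : T -> Omega -> R) :
  (forall t, measurable_fun setT (f t)) ->
  measurable_fun setT (fun w => maxabs t0 (fun t => f t w)).
Proof.
move=> mf; apply: (@measurable_maxf _ _ _ _ (fun t w => `|f t w|)) => t.
by apply: measurableT_comp (mf t); exact: normr_measurable.
Qed.

Lemma maxabs_le (T : finType) (t0 : T) (a : T -> R) c :
  (forall t, `|a t| <= c) -> maxabs t0 a <= c.
Proof. by move=> h; apply: maxf_le. Qed.

Lemma maxabs_close (T : finType) (t0 : T) (a b : T -> R) e :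
  (forall t, `|a t - b t| <= e) -> maxabs t0 a <= maxabs t0 b + e.
Proof.
move=> h; apply: maxabs_le => t.
have := h t; have := maxf_ge t0 (fun t => `|b t|) t; rewrite -/(maxabs t0 b).
have := ler_normD (a t - b t) (b t); rewrite subrK; lra.
Qed.

(** On [[-1, 1]], [grid (discr k r)] is [r] rounded down to a multiple of [1 / k]; [minn] keeps the
    index in range for larger [r]. *)
Definition discr (k : nat) (r : R) : 'I_(2 * k).+1 :=
  inord (minn (Num.truncn ((r + 1) * k%:R)) (2 * k)).

Definition grid (k : nat) (j : 'I_(2 * k).+1) : R := j%:R / k%:R - 1.

Lemma measurable_discr d (E : measurableType d) (f : E -> R) k j :
  measurable_fun setT f -> measurable [set x | discr k (f x) = j].
Proof.
move=> mf.
(* Read as a real number, the index is nondecreasing in [r], hence Borel measurable. *)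
pose phi (r : R) : R := (minn (Num.truncn ((r + 1) * k%:R)) (2 * k))%:R.
have mphi : measurable_fun setT phi.
  apply: nondecreasing_measurable => // x y xy.
  rewrite /phi ler_nat leq_min geq_minr andbT geq_min; apply/orP; left.
  by apply: le_truncn; rewrite ler_wpM2r // lerD2r.
rewrite (_ : [set x | _] = setT `&` (phi \o f) @^-1` [set (j%:R : R)]).
  apply: (measurableT_comp mphi mf) => //.
rewrite setTI; apply/seteqP; split => x /=.
  by move=> <-; rewrite /phi /discr inordK // ltnS geq_minr.
rewrite /phi => /eqP; rewrite eqr_nat => /eqP h; apply/val_inj => /=.
by rewrite inordK ?h // ltnS.
Qed.

Lemma grid_bounds k (r : R) : (0 < k)%N -> `|r| <= 1 ->
  [/\ grid (discr k r) <= r, r <= grid (discr k r) + k%:R^-1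
    & `|grid (discr k r)| <= 1].
Proof.
move=> k0; rewrite ler_norml => /andP[r1 r2].
have kR : 0 < k%:R :> R by rewrite ltr0n.
have h0 : 0 <= (r + 1) * k%:R by rewrite mulr_ge0 //; lra.
have /andP[t1 t2] := truncn_itv h0.
have tk : (Num.truncn ((r + 1) * k%:R) <= 2 * k)%N.
  rewrite -(ler_nat R); apply: le_trans t1 _.
  by rewrite natrM ler_wpM2r //; lra.
have e : grid (discr k r) = (Num.truncn ((r + 1) * k%:R))%:R / k%:R - 1.
  by rewrite /grid /discr (minn_idPl tk) inordK.
have b1 : grid (discr k r) <= r by rewrite e lerBlDr ler_pdivrMr.
have b2 : - 1 <= grid (discr k r).
  by rewrite e lerBrDr addNr divr_ge0.
split => //.
- rewrite e addrAC -[X in _ <= _ + X - _]mul1r -mulrDl lerBrDr ler_pdivlMr //.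
  by rewrite -natr1 in t2; exact: ltW.
- by rewrite ler_norml b2; apply: le_trans b1 r2.
Qed.

End Discretization.

(** * The exponential inequality for bounded functions of independent observations *)

Section Concentration.
Context {R : realType} d (Omega : measurableType d) (Q : probability Omega R).
Context (n : nat) (dd : 'I_n -> measure_display)
  (E : forall i, measurableType (dd i)) (X : forall i, Omega -> E i).
Context (T : finType) (t0 : T) (g : forall i, T -> E i -> R) (v2 : R).

Hypothesis mX : forall i, measurable_fun setT (X i).
Hypothesis hX : independent X Q.
Hypothesis mg : forall i t, measurable_fun setT (@g i t).
Hypothesis gb : forall i t x, `|@g i t x| <= 1.

Let gX i t w := @g i t (X i w).
Let m i t := \int[Q]_w gX i t w.
Let Z w := maxabs t0 (fun t => \sum_i (gX i t w - m i t)).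
Hypothesis hv : forall t, \sum_i \int[Q]_w (gX i t w) ^+ 2 <= v2.

Let mgX i t : measurable_fun setT (gX i t).
Proof. exact: (measurableT_comp (@mg i t) (@mX i)). Qed.

Let igX i t : Q.-integrable setT (EFin \o gX i t).
Proof.
by apply: (@bounded_integrable _ _ _ _ _ 1); [exact: mgX | move=> w; exact: gb].
Qed.

Let m_le1 i t : `|m i t| <= 1.
Proof.
apply: le_trans (le_normr_Rintegral measurableT (igX i t)) _.
rewrite -[leRHS](Rintegral_prob_cst Q); apply: le_Rintegral => //.
- apply: (@bounded_integrable _ _ _ _ _ 1); last by move=> w; rewrite normr_id; exact: gb.
  exact/measurable_funnorm/mgX.
- exact: cst_integrable.
- by move=> w _; exact: gb.
Qed.

Let mZ : measurable_fun setT Z.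
Proof.
apply: (@measurable_maxabs _ _ _ _ t0 (fun t w => \sum_i (gX i t w - m i t))) => t.
by apply: measurable_sum => i; apply: measurable_funB => //; exact: mgX.
Qed.

Let Zb w : `|Z w| <= (2 * n)%:R.
Proof.
rewrite ger0_norm ?maxabs_ge0 //; apply: maxabs_le => t.
apply: le_trans (ler_norm_sum _ _ _) _.
apply: (@le_trans _ _ (\sum_(i < n) 2)).
  apply: ler_sum => i _; apply: le_trans (ler_normB _ _) _.
  have := gb t (X i w); have := m_le1 i t; rewrite /gX; lra.
by rewrite sumr_const card_ord natrM mulr_natr.
Qed.

Lemma maxabs_deviation_integrable : Q.-integrable setT (EFin \o Z).
Proof. exact: bounded_integrable mZ Zb. Qed.

Lemma exp_maxabs_deviation_integrable (c : R) : 0 <= c ->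
  Q.-integrable setT (EFin \o (fun w => expR (c * Z w))).
Proof.
move=> c0; apply: (@bounded_integrable _ _ _ _ _ (expR (c * (2 * n)%:R))).
  by apply: measurableT_comp => //; apply: measurable_funM.
move=> w; rewrite ger0_norm ?expR_ge0 // ler_expR ler_wpM2l //.
exact: le_trans (ler_norm _) (Zb w).
Qed.

(** Quantizing with mesh [1 / k] moves the maximum by at most [n / k] and the variance bound by at
    most [2 n / k], and makes [finite_concentration] applicable. *)
Let approx (k : nat) : (0 < k)%N ->
  \int[Q]_w expR (1 / 300 * Z w) <=
  expR (1 / 300 * (27 / 25 * \int[Q]_w Z w + 1 / 100 * v2) + n%:R / k%:R).
Proof.
move=> k0; set ik : R := k%:R^-1.
have ik0 : 0 <= ik by rewrite invr_ge0.
(* A letter records the quantized values of all the functions [g i t] at once. *)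
pose A : finType := {ffun T -> 'I_(2 * k).+1}.
pose q i (x : E i) : A := [ffun t => discr k (@g i t x)].
have mq i z : measurable (@q i @^-1` [set z]).
  rewrite (_ : _ @^-1` _ = \bigcap_(t in [set: T]) [set x | discr k (@g i t x) = z t]).
    apply: fin_bigcap_measurable => // t _; exact: measurable_discr.
  apply/seteqP; split => x /=; first by move=> <- t _; rewrite /q ffunE.
  by move=> h; apply/ffunP => t; rewrite ffunE; exact: h.
pose p := value_pmf Q X q.
have hp i : pmf (p i) by exact: pmf_value.
pose val (z : A) t : R := grid (z t).
have val_q i x t : [/\ val (@q i x) t <= @g i t x, @g i t x <= val (@q i x) t + ik
    & `|val (@q i x) t| <= 1].
  by rewrite /val /q ffunE; exact: grid_bounds.
have mH i (H : A -> R) : measurable_fun setT (fun w => H (q i (X i w))).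
  rewrite (_ : (fun w => _) = fun w =>
     \sum_z H z * \1_(X i @^-1` (@q i @^-1` [set z])) w).
    apply: measurable_sum => z; apply: measurable_funM => //.
    by apply: measurable_indic; exact: measurable_value.
  apply/funext => w; rewrite (bigD1 (q i (X i w))) //= big1 ?addr0.
    by rewrite indicE mem_set // mulr1.
  move=> z /negP zq; rewrite indicE memNset ?mulr0 //= => e.
  by apply: zq; rewrite -e.
(* [H] is shifted by [1] because [integral_finite_valued] concerns nonnegative functions. *)
have sum_p i (H : A -> R) (M : R) : (forall w, `|H (q i (X i w))| <= M) ->
    (forall z, - 1 <= H z) ->
    \sum_z p i z * H z = \int[Q]_w H (q i (X i w)).
  move=> HM H1.
  have iH := bounded_integrable Q (mH i H) HM.
  have e1 : \int[Q]_w (H (q i (X i w)) + 1) = \sum_z p i z * (H z + 1).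
    rewrite /Rintegral (@integral_finite_valued _ _ _ _ A (fun w => q i (X i w))
        (fun z => H z + 1)) // => z; last by have := H1 z; lra.
    exact: measurable_value.
  have i1 := cst_integrable Q 1.
  rewrite RintegralD // Rintegral_prob_cst in e1.
  apply: (addIr 1); rewrite e1.
  rewrite -{1}(pmf_sum_const 1 (hp i)) -big_split /=.
  by apply: eq_bigr => z _; rewrite mulrDr.
have val1 (z : A) t : `|val z t| <= 1.
  have kR : 0 < k%:R :> R by rewrite ltr0n.
  rewrite /val /grid ler_norml lerBrDr addNr divr_ge0 //=.
  rewrite lerBlDr ler_pdivrMr // (_ : 1 + 1 = 2%:R) // -natrM ler_nat.
  by rewrite -ltnS.
have grid_lb (z : A) t : - 1 <= val z t.
  by rewrite /val /grid lerBrDr addNr divr_ge0.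
have val_qb i t w : `|val (q i (X i w)) t| <= 1 by have [] := val_q i (X i w) t.
pose mk i t := \sum_z p i z * val z t.
have emk i t : mk i t = \int[Q]_w val (q i (X i w)) t.
  by apply: (sum_p i (fun z => val z t) 1).
have ival i t : Q.-integrable setT (EFin \o (fun w => val (q i (X i w)) t)).
  exact: bounded_integrable (mH i (fun z => val z t)) (val_qb i t).
have mk_m i t : mk i t <= m i t <= mk i t + ik.
  rewrite emk; apply/andP; split.
    by apply: le_Rintegral => // w _; have [] := val_q i (X i w) t.
  rewrite -[X in _ + X](Rintegral_prob_cst Q) -RintegralD //; last exact: cst_integrable.
  apply: le_Rintegral => //.
    have := integrableD measurableT (ival i t) (cst_integrable Q ik).
    by apply: eq_integrable => // w _.
  by move=> w _; have [] := val_q i (X i w) t.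
pose u i (z : A) t := val z t - mk i t.
have uZ : forall (t : T) (w : Omega), `|\sum_i u i (q i (X i w)) t - \sum_i (gX i t w - m i t)| <= n%:R * ik.
  move=> t w.
  rewrite -sumrB; apply: le_trans (ler_norm_sum _ _ _) _.
  apply: (@le_trans _ _ (\sum_(i < n) ik)).
    apply: ler_sum => i _; rewrite /u /gX; have /andP[] := mk_m i t.
    have [a1 a2 _] := val_q i (X i w) t.
    by rewrite ler_norml => b1 b2; apply/andP; split; lra.
  by rewrite sumr_const card_ord mulr_natl.
pose N w := maxabs t0 (fun t => \sum_i u i (q i (X i w)) t).
have NZ w : N w <= Z w + n%:R * ik by exact: maxabs_close.
have ZN w : Z w <= N w + n%:R * ik.
  by apply: maxabs_close => t; rewrite distrC.
have mN : measurable_fun setT N.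
  apply: (@measurable_maxabs _ _ _ _ t0 (fun t w => \sum_i u i (q i (X i w)) t)) => t.
  by apply: measurable_sum => i; exact: (mH i (fun z => u i z t)).
have Nb w : `|N w| <= (2 * n)%:R + n%:R * ik.
  rewrite ger0_norm ?maxabs_ge0 //; apply: le_trans (NZ w) _.
  by rewrite lerD2r (le_trans (ler_norm _) (Zb w)).
have iN := bounded_integrable Q mN Nb.
have iZ := maxabs_deviation_integrable.
have EN : \int[Q]_w N w = iexp p u (enum 'I_n) (maxabs t0) (fun=> 0).
  rewrite /Rintegral integral_iexp // => a; exact: maxabs_ge0.
have EexpN : \int[Q]_w expR (1 / 300 * N w) =
    iexp p u (enum 'I_n) (fun a => expR (1 / 300 * maxabs t0 a)) (fun=> 0).
  rewrite /Rintegral.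
  have := @integral_iexp _ _ _ Q _ _ _ X A q mX hX mq T u
    (fun a => expR (1 / 300 * maxabs t0 a)) (fun a => expR_ge0 _).
  by move=> ->.
have u0 i t : \sum_z p i z * u i z t = 0.
  under eq_bigr do rewrite mulrBr.
  by rewrite sumrB pmf_sum_const // subrr.
have mk1 i t : `|mk i t| <= 1.
  apply: le_trans (ler_norm_sum _ _ _) _.
  rewrite -(hp i).2; apply: ler_sum => z _.
  by rewrite normrM ger0_norm ?(hp i).1 // ler_piMr ?(hp i).1.
have ub i z t : `|u i z t| <= 2.
  apply: le_trans (ler_normB _ _) _; have := val1 z t; have := mk1 i t; lra.
have uv t : \sum_(i <- enum 'I_n) \sum_z p i z * u i z t ^+ 2 <= v2 + 2 * n%:R * ik.
  rewrite big_enum /=.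
  apply: (@le_trans _ _ (\sum_i (\int[Q]_w (gX i t w) ^+ 2 + 2 * ik))); last first.
    rewrite big_split /= sumr_const card_ord -mulr_natl.
    have := hv t; lra.
  apply: ler_sum => i _.
  apply: (@le_trans _ _ (\sum_z p i z * val z t ^+ 2)).
    rewrite -subr_ge0 (_ : _ - _ = mk i t ^+ 2) ?sqr_ge0 //.
    transitivity (2 * mk i t * mk i t - \sum_z p i z * mk i t ^+ 2); last first.
      by rewrite pmf_sum_const //; ring.
    rewrite {2}/mk mulr_sumr -!sumrB; apply: eq_bigr => z _.
    by rewrite /u; ring.
  have vb2 w : `|val (q i (X i w)) t ^+ 2| <= 1.
    by rewrite normrX exprn_ile1.
  rewrite (sum_p i (fun z => val z t ^+ 2) 1) //; last first.
    by move=> z; apply: le_trans (sqr_ge0 _); rewrite lerN10.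
  have ig2 : Q.-integrable setT (EFin \o (fun w => gX i t w ^+ 2)).
    apply: (@bounded_integrable _ _ _ _ _ 1); first exact/measurable_funX/mgX.
    by move=> w; rewrite normrX exprn_ile1 //; exact: gb.
  rewrite -[X in _ + X](Rintegral_prob_cst Q) -RintegralD //; last exact: cst_integrable.
  apply: le_Rintegral => //.
  - apply: bounded_integrable vb2; exact: (mH i (fun z => val z t ^+ 2)).
  - have := integrableD measurableT ig2 (cst_integrable Q (2 * ik)).
    by apply: eq_integrable => // w _.
  - move=> w _; have [a1 a2 a3] := val_q i (X i w) t.
    have := gb t (X i w); rewrite /gX.
    move: a1 a2 a3; set a := val _ _; set b := g t _ => a1 a2.
    rewrite !ler_norml => /andP[a3 a4] /andP[b3 b4].
    (* Here [0 <= b - a <= ik] and [b + a >= -2]. *)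
    have : (b - a) * (b + a) >= - (2 * ik).
      have [s0|s0] := leP 0 (b + a).
        by apply: (@le_trans _ _ 0); [lra | rewrite mulr_ge0 // subr_ge0].
      nra.
    lra.
have fc := finite_concentration t0 hp u0 ub uv erefl.
rewrite -EexpN -EN in fc; clear EexpN.
have l0 : 0 <= 1 / 300 :> R by lra.
(* The mesh errors sum to [21/10 lam n / k], which [lam <= 1 / 3] keeps below [n / k]. *)
have l1 : 1 / 300 <= 1 / 3 :> R by lra.
move: (1 / 300 : R) l0 l1 fc => lam l0 l1 fc.
apply: (@le_trans _ _ (\int[Q]_w (expR (lam * (n%:R * ik)) * expR (lam * N w)))).
  apply: le_Rintegral => //.
  - exact: exp_maxabs_deviation_integrable.
  - apply: (@bounded_integrable _ _ _ _ _
      (expR (lam * (n%:R * ik)) * expR (lam * ((2 * n)%:R + n%:R * ik)))).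
      apply: measurable_funM => //; apply: measurableT_comp => //.
      exact: measurable_funM.
    move=> w; rewrite ger0_norm ?mulr_ge0 ?expR_ge0 // ler_wpM2l ?expR_ge0 //.
    rewrite ler_expR ler_wpM2l //; exact: le_trans (ler_norm _) (Nb w).
  - by move=> w _; rewrite -expRD ler_expR -mulrDr ler_wpM2l // addrC.
rewrite RintegralZl //; last first.
  apply: (@bounded_integrable _ _ _ _ _ (expR (lam * ((2 * n)%:R + n%:R * ik)))).
    by apply: measurableT_comp => //; apply: measurable_funM.
  move=> w; rewrite ger0_norm ?expR_ge0 //.
  rewrite ler_expR ler_wpM2l //; exact: le_trans (ler_norm _) (Nb w).
apply: le_trans (ler_wpM2l (expR_ge0 _) fc) _.
rewrite -expRD ler_expR.
have ENZ : \int[Q]_w N w <= \int[Q]_w Z w + n%:R * ik.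
  rewrite -[X in _ + X](Rintegral_prob_cst Q) -RintegralD //; last exact: cst_integrable.
  apply: le_Rintegral => //.
  have := integrableD measurableT iZ (cst_integrable Q (n%:R * ik)).
  by apply: eq_integrable => // w _.
have nik : 0 <= n%:R * ik by rewrite mulr_ge0.
rewrite -/ik.
have := ler_wpM2l l0 ENZ; have := ler_wpM2r nik l1; lra.
Qed.

(** The mesh tends to zero in [approx]; after taking logarithms its error is the additive
    [n / k]. *)
Lemma exp_maxabs_deviation_le :
  \int[Q]_w expR (1 / 300 * Z w) <=
  expR (1 / 300 * (27 / 25 * \int[Q]_w Z w + 1 / 100 * v2)).
Proof.
set I := (X in X <= _).
have I0 : 0 < I.
  apply: (@lt_le_trans _ _ 1) => //.
  rewrite -[leLHS](Rintegral_prob_cst Q); apply: le_Rintegral => //.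
  - exact: cst_integrable.
  - by apply: exp_maxabs_deviation_integrable; lra.
  - move=> w _; rewrite -[leLHS]expR0 ler_expR; apply: mulr_ge0; last exact: maxabs_ge0.
    lra.
rewrite -[leLHS]lnK ?posrE // ler_expR; apply/ler_addgt0Pr => e e0.
rewrite -ler_expR lnK ?posrE //.
pose k := (Num.truncn (n%:R / e)).+1.
apply: le_trans (approx (k := k) _) _ => //.
rewrite ler_expR lerD2l ler_pdivrMr // mulrC -ler_pdivrMr //.
have /andP[_] := truncn_itv (divr_ge0 (ler0n R n) (ltW e0)).
exact: ltW.
Qed.

End Concentration.

(** * Hellinger geometry *)

Section Pointwise.
Context {R : realType}.

(* Closed form of [psi (sqrt (b / a))]; division by [0] gives the right value [0]
   when [a = b = 0]. *)
Definition rpsi (a b : R) : R := (Num.sqrt b - Num.sqrt a) / Num.sqrt (a + b).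

Lemma psi_quotE (a b : R) : 0 <= a -> 0 <= b -> psi (sqrte (quot b a)) = rpsi a b.
Proof.
move=> a0 b0; rewrite /quot /rpsi; have [->|aN0] := eqVneq a 0.
  have [->|bN0] := eqVneq b 0.
    by rewrite /= sqrtr1 sqrtr0 !subrr !mul0r.
  by rewrite /= sqrtr0 subr0 add0r divff // gt_eqF // sqrtr_gt0 lt_neqAle eq_sym bN0.
have ap : 0 < a by rewrite lt_neqAle eq_sym aN0.
have sa : 0 < Num.sqrt a by rewrite sqrtr_gt0.
rewrite /= sqrtrM // sqrtrV // exprMn exprVn !sqr_sqrtr //.
have -> : 1 + b / a = (a + b) / a by rewrite mulrDl divff.
rewrite sqrtrM ?addr_ge0 // sqrtrV //.
rewrite invfM invrK mulrA -[X in X / _ * _]mulr1 mulrAC; congr (_ / _).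
by rewrite mulr1 mulrBl mul1r -mulrA mulVf ?gt_eqF // mulr1.
Qed.

Lemma rpsi_le1 (a b : R) : 0 <= a -> 0 <= b -> `|rpsi a b| <= 1.
Proof.
move=> a0 b0; rewrite /rpsi normrM normfV [X in _ / X]ger0_norm ?sqrtr_ge0 //.
have [->|abN0] := eqVneq (a + b) 0; first by rewrite sqrtr0 invr0 mulr0.
have abp : 0 < a + b by rewrite lt_neqAle eq_sym abN0 addr_ge0.
rewrite ler_pdivrMr ?sqrtr_gt0 // mul1r.
rewrite -ler_sqr ?nnegrE ?sqrtr_ge0 // real_normK ?num_real // sqr_sqrtr ?addr_ge0 //.
rewrite -{2}(sqr_sqrtr a0) -{2}(sqr_sqrtr b0).
have := mulr_ge0 (sqrtr_ge0 a) (sqrtr_ge0 b).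
by set p := Num.sqrt a; set q := Num.sqrt b => ?; nra.
Qed.

Lemma rpsi_mul (a b : R) : 0 <= a -> 0 <= b ->
  rpsi a b * Num.sqrt (a + b) = Num.sqrt b - Num.sqrt a.
Proof.
move=> a0 b0; rewrite /rpsi.
have [ab|abN0] := eqVneq (a + b) 0.
  have [-> ->] : a = 0 /\ b = 0 by lra.
  by rewrite addr0 sqrtr0 mulr0 subrr.
have abp : 0 < a + b by rewrite lt_neqAle eq_sym abN0 addr_ge0.
by rewrite divfK // gt_eqF // sqrtr_gt0.
Qed.

(** Both sides have the same quadratic terms, as [r^2 = (p^2 + q^2) / 2]. The cross terms compare
    because [z >= 0] and the quadratic mean [r] is at least [(p + q) / 2]. *)
Lemma sqrt_mid (z a b : R) : 0 <= z -> 0 <= a -> 0 <= b ->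
  (z - Num.sqrt ((a + b) / 2)) ^+ 2 <=
  1 / 2 * ((z - Num.sqrt a) ^+ 2 + (z - Num.sqrt b) ^+ 2).
Proof.
move=> z0 a0 b0; set r := Num.sqrt (_ / 2).
have r2 : r ^+ 2 = (a + b) / 2 by rewrite sqr_sqrtr // divr_ge0 // addr_ge0.
have r0 : 0 <= r by exact: sqrtr_ge0.
have := sqr_sqrtr a0; have := sqr_sqrtr b0.
have := sqrtr_ge0 a; have := sqrtr_ge0 b.
set p := Num.sqrt a; set q := Num.sqrt b => q0 p0 q2 p2.
have rpq : p + q <= 2 * r.
  rewrite -ler_sqr ?nnegrE ?addr_ge0 ?mulr_ge0 // exprMn r2.
  have := sqr_ge0 (p - q); nra.
have := ler_wpM2l z0 rpq; nra.
Qed.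

(** With [y = rpsi a b] and [r] the root of the midpoint, [z^2 <= 2 (z - r)^2 + 2 r^2] is multiplied
    by [y^2 <= 1]. Then [2 r^2 y^2 = (q - p)^2] costs two of the three units and [sqrt_mid] the
    third. *)
Lemma second_moment_pointwise (c a b : R) : 0 <= c -> 0 <= a -> 0 <= b ->
  c * rpsi a b ^+ 2 <=
  3 * ((Num.sqrt c - Num.sqrt a) ^+ 2 + (Num.sqrt c - Num.sqrt b) ^+ 2).
Proof.
move=> c0 a0 b0; have := sqrt_mid (sqrtr_ge0 c) a0 b0.
have := rpsi_mul a0 b0; have := rpsi_le1 a0 b0.
have -> : Num.sqrt (a + b) = Num.sqrt 2 * Num.sqrt ((a + b) / 2).
  by rewrite -sqrtrM // mulrC divfK.
have s2 : Num.sqrt 2 ^+ 2 = 2 :> R by rewrite sqr_sqrtr.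
have := sqr_sqrtr c0; rewrite ler_norml.
move: (rpsi a b) (Num.sqrt a) (Num.sqrt b) (Num.sqrt c) (Num.sqrt 2) s2
  (Num.sqrt ((a + b) / 2)).
move=> y p q z w w2 r <- /andP[y1 y2] hy hm.
have y21 : y ^+ 2 <= 1 by nra.
have e1 : z ^+ 2 <= 2 * (z - r) ^+ 2 + 2 * r ^+ 2.
  by have := sqr_ge0 (z - 2 * r); lra.
have e2 : 2 * r ^+ 2 * y ^+ 2 = (q - p) ^+ 2.
  by rewrite -hy -w2; ring.
have e3 : (q - p) ^+ 2 <= 2 * ((z - p) ^+ 2 + (z - q) ^+ 2).
  by have := sqr_ge0 (2 * z - p - q); lra.
have e4 : (z - r) ^+ 2 * y ^+ 2 <= (z - r) ^+ 2.
  by rewrite ler_piMr ?sqr_ge0.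
have := ler_wpM2r (sqr_ge0 y) e1; lra.
Qed.

(** The affinities complete the square in [z - r]: beyond half the difference of the squared
    distances and the term [1 / 2 * (b - a)], which integrates to zero between densities, only a
    multiple of [y (z - r)^2] is left. It is bounded by [|y| <= 1] and [sqrt_mid]. *)
Lemma bias_pointwise (c a b : R) : 0 <= c -> 0 <= a -> 0 <= b ->
  1 / 2 * (Num.sqrt (b * ((a + b) / 2)) - Num.sqrt (a * ((a + b) / 2)))
  + 1 / Num.sqrt 2 * (c * rpsi a b) <=
  1 / 2 * ((Num.sqrt c - Num.sqrt a) ^+ 2 - (Num.sqrt c - Num.sqrt b) ^+ 2)
  + 1 / 2 * (b - a)
  + 1 / 2 * (1 / Num.sqrt 2) *
    ((Num.sqrt c - Num.sqrt a) ^+ 2 + (Num.sqrt c - Num.sqrt b) ^+ 2).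
Proof.
move=> c0 a0 b0; have hm := sqrt_mid (sqrtr_ge0 c) a0 b0.
rewrite (sqrtrM _ b0) (sqrtrM _ a0).
have hy := rpsi_mul a0 b0; have y1 := rpsi_le1 a0 b0.
have es : Num.sqrt (a + b) = Num.sqrt 2 * Num.sqrt ((a + b) / 2).
  by rewrite -sqrtrM // mulrC divfK.
rewrite es in hy.
have w2 : Num.sqrt 2 ^+ 2 = 2 :> R by rewrite sqr_sqrtr.
have w0 : 0 < Num.sqrt 2 :> R by rewrite sqrtr_gt0.
have hz := sqr_sqrtr c0; have hp := sqr_sqrtr a0; have hq := sqr_sqrtr b0.
have r2 : Num.sqrt ((a + b) / 2) ^+ 2 = (a + b) / 2 by rewrite sqr_sqrtr // divr_ge0 // addr_ge0.
have -> : 1 / Num.sqrt 2 = Num.sqrt 2 / 2 :> R.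
  move: w2 w0; set w := Num.sqrt 2 => w2 w0.
  by rewrite -w2; field; rewrite gt_eqF.
have z0 := sqrtr_ge0 c.
move: w2 w0 hz hp hq hy y1 hm r2; rewrite ler_norml.
move: (rpsi a b) (Num.sqrt a) (Num.sqrt b) (Num.sqrt c) z0 (Num.sqrt 2)
  (Num.sqrt ((a + b) / 2)).
move=> y p q z z0 w r w2 w0 <- <- <- hy /andP[y1 y2] hm r2.
set k := (z - p) ^+ 2 + (z - q) ^+ 2 in hm *.
(* [w y r = q - p] and [2 r^2 = p^2 + q^2] turn the left-hand side into
   [(q - p) z + w / 2 * y * (z - r)^2]. *)
have e1 : 1 / 2 * (q * r - p * r) + w / 2 * (z ^+ 2 * y) =
    (q - p) * z + w / 2 * (y * (z - r) ^+ 2).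
  transitivity (1 / 2 * (y * (w * r)) * r + w / 2 * (z ^+ 2 * y)).
    by rewrite hy; ring.
  by rewrite -hy; field.
have e2 : (q - p) * z = 1 / 2 * ((z - p) ^+ 2 - (z - q) ^+ 2) + 1 / 2 * (q ^+ 2 - p ^+ 2).
  by field.
rewrite e1 e2 lerD2l.
have -> : 1 / 2 * (w / 2) * k = w / 2 * (1 / 2 * k) by ring.
rewrite ler_pM2l ?divr_gt0 //; apply: le_trans hm.
by rewrite ler_piMl ?sqr_ge0.
Qed.

End Pointwise.

(** * Hellinger distance, second moments and bias on one coordinate *)

Section Densities.
Context {R : realType} d (E : measurableType d) (mu : {measure set E -> \bar R}).
Implicit Types s t v : density mu.

Let md s : measurable_fun setT s.
Proof. exact: density_measurable. Qed.

Let d0 s x : 0 <= s x.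
Proof. exact: density_ge0. Qed.

Lemma density_integrable s : mu.-integrable setT (EFin \o s).
Proof.
apply/integrableP; split; first exact/measurable_EFinP/md.
rewrite (eq_integral (fun x => (s x)%:E)) ?density_int1 ?ltry // => x _ /=.
by rewrite ger0_norm // d0.
Qed.

Lemma Rintegral_density s : \int[mu]_x s x = 1.
Proof. by rewrite /Rintegral density_int1. Qed.

Lemma dominated_integrable s t v (c : R) (f : E -> R) :
  measurable_fun setT f -> (forall x, `|f x| <= c * (s x + t x + v x)) ->
  mu.-integrable setT (EFin \o f).
Proof.
move=> mf hf.
apply: (@le_integrable _ _ _ mu _ measurableT _
    (EFin \o (fun x => c * (s x + t x + v x)))) => //.
- exact/measurable_EFinP.
- by move=> x _ /=; rewrite lee_fin (le_trans (hf x)) // ler_norm.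
- have h := integrableD measurableT
    (integrableD measurableT (density_integrable s) (density_integrable t))
    (density_integrable v).
  have := integrableZl measurableT c h.
  by apply: eq_integrable => // x _ /=.
Qed.

Lemma sqrt_density_measurable s : measurable_fun setT (fun x => Num.sqrt (s x)).
Proof. exact: measurableT_comp (continuous_measurable_fun (@sqrt_continuous R)) (md s). Qed.

Let msqd s t : measurable_fun setT (fun x => (Num.sqrt (s x) - Num.sqrt (t x)) ^+ 2).
Proof.
apply: measurable_funX.
by apply: measurable_funB; exact: sqrt_density_measurable.
Qed.

Lemma hell2_integrable s t :
  mu.-integrable setT (EFin \o (fun x => (Num.sqrt (s x) - Num.sqrt (t x)) ^+ 2)).
Proof.
apply: (@dominated_integrable s t s 1); first exact: msqd.
move=> x; rewrite ger0_norm ?sqr_ge0 // mul1r.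
have := sqr_sqrtr (d0 s x); have := sqr_sqrtr (d0 t x).
have := sqrtr_ge0 (s x); have := sqrtr_ge0 (t x).
set p := Num.sqrt (s x); set q := Num.sqrt (t x) => q0 p0 <- <-; nra.
Qed.

Lemma hell2_ge0 s t : 0 <= hell2 mu s t.
Proof. by rewrite mulr_ge0 // Rintegral_ge0 // => x _; rewrite sqr_ge0. Qed.

Lemma hell2C s t : hell2 mu s t = hell2 mu t s.
Proof.
by congr (_ * _); apply: eq_Rintegral => x _; rewrite -sqrrN opprB.
Qed.

(** Young's inequality under the integral. Optimizing [c] recovers the triangle inequality; [c = 1]
    serves to compare a model with its net. *)
Lemma hell2_quasi_triangle s t v (c : R) : 0 < c ->
  hell2 mu s v <= (1 + c) * hell2 mu s t + (1 + c^-1) * hell2 mu t v.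
Proof.
move=> c0.
have h1 := hell2_integrable s t; have h2 := hell2_integrable t v.
have -> : (1 + c) * hell2 mu s t + (1 + c^-1) * hell2 mu t v =
  1 / 2 * \int[mu]_x ((1 + c) * (Num.sqrt (s x) - Num.sqrt (t x)) ^+ 2 +
     (1 + c^-1) * (Num.sqrt (t x) - Num.sqrt (v x)) ^+ 2).
  rewrite RintegralD ?RintegralZl //; first by rewrite /hell2; ring.
    by have := integrableZl measurableT (1 + c) h1; apply: eq_integrable.
  by have := integrableZl measurableT (1 + c^-1) h2; apply: eq_integrable.
rewrite /hell2 ler_pM2l //; apply: le_Rintegral => //.
- exact: hell2_integrable.
- have := integrableD measurableT (integrableZl measurableT (1 + c) h1)
    (integrableZl measurableT (1 + c^-1) h2).
  by apply: eq_integrable.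
- move=> x _; set p := Num.sqrt (s x); set q := Num.sqrt (t x); set r := Num.sqrt (v x).
  have ci : c * c^-1 = 1 by rewrite divff ?gt_eqF.
  have c1 : 0 < c^-1 by rewrite invr_gt0.
  have : 0 <= c^-1 * (c * (p - q) - (q - r)) ^+ 2 by rewrite mulr_ge0 ?sqr_ge0 // ltW.
  have -> : c^-1 * (c * (p - q) - (q - r)) ^+ 2 =
    c * (c * c^-1) * (p - q) ^+ 2 - 2 * (c * c^-1) * (p - q) * (q - r) + c^-1 * (q - r) ^+ 2 by ring.
  rewrite ci; lra.
Qed.

Lemma rpsi_measurable s t : measurable_fun setT (fun x => rpsi (s x) (t x)).
Proof.
apply: measurable_funM.
  by apply: measurable_funB; exact: sqrt_density_measurable.
rewrite (_ : (fun x => _) = (fun x => (Num.sqrt (s x + t x)) `^ (-1))).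
  apply: (measurableT_comp (measurable_powR (-1))).
  apply: measurableT_comp (continuous_measurable_fun (@sqrt_continuous R)) _.
  by apply: measurable_funD; exact: md.
by apply/funext => x; rewrite powR_inv1 ?sqrtr_ge0.
Qed.

Lemma density_rpsi_second_moment s t v :
  \int[mu]_x (s x * rpsi (t x) (v x) ^+ 2) <= 6 * (hell2 mu s t + hell2 mu s v).
Proof.
have h1 := hell2_integrable s t; have h2 := hell2_integrable s v.
have -> : 6 * (hell2 mu s t + hell2 mu s v) =
  \int[mu]_x (3 * ((Num.sqrt (s x) - Num.sqrt (t x)) ^+ 2 +
                (Num.sqrt (s x) - Num.sqrt (v x)) ^+ 2)).
  rewrite RintegralZl // ?RintegralD //; first by rewrite /hell2; field.
  by have := integrableD measurableT h1 h2; apply: eq_integrable.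
apply: le_Rintegral => //.
- apply: (@dominated_integrable s s s 1).
    apply: measurable_funM; first exact: md.
    exact/measurable_funX/rpsi_measurable.
  move=> x; rewrite normrM ger0_norm ?d0 // normrX.
  apply: (@le_trans _ _ (s x)).
    by rewrite ler_piMr ?d0 // exprn_ile1 // rpsi_le1 ?d0.
  by have := d0 s x; lra.
- have := integrableZl measurableT 3 (integrableD measurableT h1 h2).
  by apply: eq_integrable.
- by move=> x _; apply: second_moment_pointwise; exact: d0.
Qed.

Lemma affinity_integrable s t v :
  mu.-integrable setT (EFin \o (fun x => Num.sqrt (s x * ((t x + v x) / 2)))).
Proof.
apply: (@dominated_integrable s t v 1).
  apply: measurableT_comp (continuous_measurable_fun (@sqrt_continuous R)) _.
  apply: measurable_funM; first exact: md.
  by apply: measurable_funM => //; apply: measurable_funD; exact: md.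
move=> x; rewrite ger0_norm ?sqrtr_ge0 // mul1r.
have := d0 s x; have := d0 t x; have := d0 v x => v0 t0 s0.
have st : 0 <= s x + t x + v x by lra.
rewrite -ler_sqr ?nnegrE ?sqrtr_ge0 // sqr_sqrtr ?mulr_ge0 ?divr_ge0 ?addr_ge0 //.
nra.
Qed.

Lemma density_bias s t v :
  1 / 2 * (affinity mu v (fun x => (t x + v x) / 2)
           - affinity mu t (fun x => (t x + v x) / 2))
  + 1 / Num.sqrt 2 * \int[mu]_x (s x * rpsi (t x) (v x)) <=
  (1 + 1 / Num.sqrt 2) * hell2 mu s t - (1 - 1 / Num.sqrt 2) * hell2 mu s v.
Proof.
have h1 := hell2_integrable s t; have h2 := hell2_integrable s v.
have a1 := affinity_integrable v t v; have a2 := affinity_integrable t t v.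
have i1 := density_integrable t; have i2 := density_integrable v.
have i3 : mu.-integrable setT (EFin \o (fun x => s x * rpsi (t x) (v x))).
  apply: (@dominated_integrable s s s 1).
    by apply: measurable_funM; [exact: md | exact: rpsi_measurable].
  move=> x; rewrite normrM ger0_norm ?d0 //.
  apply: (@le_trans _ _ (s x)); first by rewrite ler_piMr ?d0 // rpsi_le1 ?d0.
  by have := d0 s x; lra.
have intZ k f (i : mu.-integrable setT (EFin \o f)) :
    mu.-integrable setT (EFin \o (fun x => k * f x)).
  by have := integrableZl measurableT k i; apply: eq_integrable.
have intD f g (i : mu.-integrable setT (EFin \o f)) (j : mu.-integrable setT (EFin \o g)) :
    mu.-integrable setT (EFin \o (fun x => f x + g x)).
  by have := integrableD measurableT i j; apply: eq_integrable.
have intB f g (i : mu.-integrable setT (EFin \o f)) (j : mu.-integrable setT (EFin \o g)) :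
    mu.-integrable setT (EFin \o (fun x => f x - g x)).
  by have := integrableB measurableT i j; apply: eq_integrable.
have -> : 1 / 2 * (affinity mu v (fun x => (t x + v x) / 2)
           - affinity mu t (fun x => (t x + v x) / 2))
  + 1 / Num.sqrt 2 * \int[mu]_x (s x * rpsi (t x) (v x)) =
  \int[mu]_x (1 / 2 * (Num.sqrt (v x * ((t x + v x) / 2))
                   - Num.sqrt (t x * ((t x + v x) / 2)))
    + 1 / Num.sqrt 2 * (s x * rpsi (t x) (v x))).
  by rewrite RintegralD ?RintegralZl ?RintegralB //; [exact/intB | exact/intZ/intB | exact/intZ].
have -> : (1 + 1 / Num.sqrt 2) * hell2 mu s t - (1 - 1 / Num.sqrt 2) * hell2 mu s v =
  \int[mu]_x (1 / 2 * ((Num.sqrt (s x) - Num.sqrt (t x)) ^+ 2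
                        - (Num.sqrt (s x) - Num.sqrt (v x)) ^+ 2)
    + 1 / 2 * (v x - t x)
    + 1 / 2 * (1 / Num.sqrt 2) *
      ((Num.sqrt (s x) - Num.sqrt (t x)) ^+ 2 + (Num.sqrt (s x) - Num.sqrt (v x)) ^+ 2)).
  rewrite RintegralD ?RintegralD ?RintegralZl ?RintegralB ?RintegralD //;
    try by [apply/intB | apply/intD | apply/intZ/intB | apply/intZ/intD
           | apply/intD; apply/intZ/intB].
  rewrite !Rintegral_density /hell2; ring.
apply: le_Rintegral => //.
- by apply/intD; [apply/intZ/intB | apply/intZ].
- by apply/intD; [apply/intD; apply/intZ => //; apply/intB | apply/intZ/intD].
- by move=> x _; apply: bias_pointwise; exact: d0.
Qed.

End Densities.

(** * Expectations under a law given by its density *)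

Section DensityExpectation.
Context {R : realType} d (E : measurableType d) (mu : {measure set E -> \bar R}).
Context d' (Omega : measurableType d') (Q : probability Omega R) (Y : Omega -> E)
  (s : density mu).
Hypothesis mY : measurable_fun setT Y.
Hypothesis hQ : forall A, measurable A ->
  (Q (Y @^-1` A) = \int[mu]_(x in A) (s x)%:E)%E.

Let ms : measurable_fun setT s.
Proof. exact: density_measurable. Qed.

Let s0 x : 0 <= s x.
Proof. exact: density_ge0. Qed.

Let density_integral_finite_valued (B : finType) (q : E -> B) (G : B -> R) :
  (forall b, measurable (q @^-1` [set b])) -> (forall b, 0 <= G b) ->
  \int[Q]_w G (q (Y w)) = \int[mu]_x (s x * G (q x)).
Proof.
move=> mq G0.
have mb b : measurable (Y @^-1` (q @^-1` [set b])).
  by rewrite -[X in measurable X]setTI; exact: mY.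
rewrite /Rintegral (integral_finite_valued (Y := fun w => q (Y w)) Q mb G0).
congr fine; rewrite -sumEFin.
transitivity (\int[mu]_x (\sum_(b : B) (G b)%:E * (s x * \1_(q @^-1` [set b]) x)%:E))%E.
  rewrite ge0_integral_sum //=.
  - apply: eq_bigr => b _; rewrite ge0_integralZl //=.
    + rewrite EFinM muleC fineK; last exact: (fin_num_measure Q _ (mb b)).
      congr (_ * _)%E.
      rewrite [LHS](hQ (mq b)) integral_mkcond; apply: eq_integral => x _.
      rewrite patchE indicE; case: (x \in _); by rewrite ?mulr1 ?mulr0.
    + apply/measurable_EFinP; apply: measurable_funM; first exact: ms.
      exact: measurable_indic.
    + by move=> x _; rewrite lee_fin mulr_ge0 ?s0.
    + by rewrite lee_fin G0.
  - move=> b; apply/measurable_EFinP; apply: measurable_funM => //.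
    by apply: measurable_funM; [exact: ms | exact: measurable_indic].
  - by move=> b x _; apply: mule_ge0; rewrite lee_fin ?mulr_ge0 ?G0 ?s0.
apply: eq_integral => x _; rewrite sumEFin (bigD1 (q x)) //= big1 ?addr0.
  by rewrite indicE mem_set // mulr1 mulrC.
move=> b /negP bq; rewrite indicE memNset ?mulr0 //= => e.
by apply: bq; rewrite e.
Qed.

(** The law of [Y] is given on sets, so the formula is first known for finite-valued functions.
    Squeezing [f] between [v] and [v + 1 / k], with [v] its quantization, bounds the difference of
    the two sides by [1 / k]. *)
Lemma density_expectation (f : E -> R) :
  measurable_fun setT f -> (forall x, `|f x| <= 1) ->
  \int[Q]_w f (Y w) = \int[mu]_x (s x * f x).
Proof.
move=> mf f1.
have intZ k g (i : mu.-integrable setT (EFin \o g)) :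
    mu.-integrable setT (EFin \o (fun x => k * g x)).
  by have := integrableZl measurableT k i; apply: eq_integrable.
have intD g h (i : mu.-integrable setT (EFin \o g)) (j : mu.-integrable setT (EFin \o h)) :
    mu.-integrable setT (EFin \o (fun x => g x + h x)).
  by have := integrableD measurableT i j; apply: eq_integrable.
have is1 := density_integrable s.
have sM (g : E -> R) (M : R) : measurable_fun setT g -> (forall x, `|g x| <= M) ->
    mu.-integrable setT (EFin \o (fun x => s x * g x)).
  move=> mg gM.
  apply: (@dominated_integrable _ _ _ _ s s s M); first exact: measurable_funM.
  move=> x; rewrite normrM (ger0_norm (s0 x)) mulrC.
  apply: ler_pM => //; have := s0 x; lra.
have key (k : nat) : (0 < k)%N ->
    `|\int[Q]_w f (Y w) - \int[mu]_x (s x * f x)| <= k%:R^-1.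
  move=> k0; set ik : R := k%:R^-1.
  pose q x := discr k (f x).
  pose v x : R := grid (q x).
  have mq z : measurable (q @^-1` [set z]) by exact: measurable_discr.
  have mv : measurable_fun setT v.
    rewrite (_ : v = fun x => \sum_z grid z * \1_(q @^-1` [set z]) x).
      by apply: measurable_sum => z; apply: measurable_funM => //; exact: measurable_indic.
    apply/funext => x; rewrite (bigD1 (q x)) //= big1 ?addr0.
      by rewrite indicE mem_set // mulr1.
    move=> z /negP zq; rewrite indicE memNset ?mulr0 //= => e.
    by apply: zq; rewrite -e.
  have vb x : [/\ v x <= f x, f x <= v x + ik & `|v x| <= 1] by exact: grid_bounds.
  have v1 x : `|v x| <= 1 by have [] := vb x.
  have eqv : \int[Q]_w v (Y w) = \int[mu]_x (s x * v x).
    have g0 (z : 'I_(2 * k).+1) : 0 <= grid z + 1 :> R by rewrite /grid subrK divr_ge0.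
    have := density_integral_finite_valued mq g0.
    rewrite RintegralD //; last 2 first.
    - exact: (bounded_integrable Q (measurableT_comp mv mY) (fun w => v1 (Y w))).
    - exact: cst_integrable.
    rewrite Rintegral_prob_cst => h; apply: (addIr 1); rewrite h.
    under eq_Rintegral do rewrite mulrDr mulr1.
    by rewrite RintegralD ?Rintegral_density //; exact: (sM _ 1).
  have ivY : Q.-integrable setT (EFin \o (fun w => v (Y w))).
    exact: (bounded_integrable Q (measurableT_comp mv mY) (fun w => v1 (Y w))).
  have ifY : Q.-integrable setT (EFin \o (fun w => f (Y w))).
    exact: (bounded_integrable Q (measurableT_comp mf mY) (fun w => f1 (Y w))).
  have isv := sM v 1 mv v1; have isf := sM f 1 mf f1.
  have a1 : \int[Q]_w v (Y w) <= \int[Q]_w f (Y w).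
    by apply: le_Rintegral => // w _; have [] := vb (Y w).
  have a2 : \int[Q]_w f (Y w) <= \int[Q]_w v (Y w) + ik.
    rewrite -[X in _ + X](Rintegral_prob_cst Q) -RintegralD //; last exact: cst_integrable.
    apply: le_Rintegral => //.
      have := integrableD measurableT ivY (cst_integrable Q ik).
      by apply: eq_integrable.
    by move=> w _; have [] := vb (Y w).
  have b1 : \int[mu]_x (s x * v x) <= \int[mu]_x (s x * f x).
    apply: le_Rintegral => // x _; rewrite ler_wpM2l //; by have [] := vb x.
  have b2 : \int[mu]_x (s x * f x) <= \int[mu]_x (s x * v x) + ik.
    have -> : \int[mu]_x (s x * v x) + ik = \int[mu]_x (s x * v x + ik * s x).
      rewrite RintegralD //; last exact/intZ.
      by rewrite RintegralZl // Rintegral_density mulr1.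
    apply: le_Rintegral => //; first by apply/intD => //; apply/intZ.
    move=> x _; have [_ h _] := vb x.
    by rewrite [ik * _]mulrC -mulrDr ler_wpM2l.
  by rewrite ler_norml; apply/andP; split; lra.
apply/eqP; rewrite -subr_eq0 -normr_le0; apply/ler_addgt0Pr => e e0.
rewrite add0r; pose k := (Num.truncn e^-1).+1.
apply: le_trans (key k _) _ => //.
rewrite invf_ple ?posrE ?ltr0n //.
have ei : 0 <= e^-1 by rewrite invr_ge0 ltW.
have /andP[_] := truncn_itv ei; exact: ltW.
Qed.

End DensityExpectation.

(** The optimal parameter is [y / x]; both numbers are first increased by [e / 2] so that this
    quotient makes sense and is positive. *)
Lemma quasi_triangle_le {R : realType} (x y z : R) : 0 <= x -> 0 <= y -> 0 <= z ->
  (forall c, 0 < c -> z ^+ 2 <= (1 + c) * x ^+ 2 + (1 + c^-1) * y ^+ 2) ->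
  z <= x + y.
Proof.
move=> x0 y0 z0 h; apply/ler_addgt0Pr => e e0.
have a0 : 0 < x + e / 2 by rewrite ltr_wpDl // divr_gt0.
have b0 : 0 < y + e / 2 by rewrite ltr_wpDl // divr_gt0.
have -> : x + y + e = (x + e / 2) + (y + e / 2) by field.
have ha : x ^+ 2 <= (x + e / 2) ^+ 2.
  by rewrite lerXn2r ?nnegrE // ?ltW // ltrDl divr_gt0.
have hb : y ^+ 2 <= (y + e / 2) ^+ 2.
  by rewrite lerXn2r ?nnegrE // ?ltW // ltrDl divr_gt0.
move: (x + e / 2) (y + e / 2) a0 b0 ha hb => a b a0 b0 ha hb.
have ab0 : 0 <= a + b by rewrite addr_ge0 ?ltW.
rewrite -ler_sqr ?nnegrE //; apply: le_trans (h _ (divr_gt0 b0 a0)) _.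
have -> : (a + b) ^+ 2 = (1 + b / a) * a ^+ 2 + (1 + (b / a)^-1) * b ^+ 2.
  by field; rewrite !gt_eqF.
have ba : 0 < b / a by rewrite divr_gt0.
by apply: lerD; rewrite ler_wpM2l // addr_ge0 // ltW // invr_gt0.
Qed.

(** * The product distance and the statistics [Tstat] and [Zstat] *)

Section ProductExperiment.
Context {R : realType} (n : nat) (d : 'I_n -> measure_display)
  (E : forall i, measurableType (d i))
  (mu : forall i, {measure set (E i) -> \bar R}).
Implicit Types s t u v : densities mu.

Lemma Hdist2_ge0 t u : 0 <= Hdist2 t u.
Proof. by apply: sumr_ge0 => i _; exact: hell2_ge0. Qed.

Lemma Hdist2C t u : Hdist2 t u = Hdist2 u t.
Proof. by apply: eq_bigr => i _; exact: hell2C. Qed.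

Lemma Hdist_ge0 t u : 0 <= Hdist t u.
Proof. exact: sqrtr_ge0. Qed.

Lemma HdistC t u : Hdist t u = Hdist u t.
Proof. by rewrite /Hdist Hdist2C. Qed.

Lemma sqr_Hdist t u : Hdist t u ^+ 2 = Hdist2 t u.
Proof. by rewrite sqr_sqrtr ?Hdist2_ge0. Qed.

Lemma Hdist2_quasi_triangle t u v (c : R) : 0 < c ->
  Hdist2 t v <= (1 + c) * Hdist2 t u + (1 + c^-1) * Hdist2 u v.
Proof.
move=> c0; rewrite /Hdist2 !mulr_sumr -big_split; apply: ler_sum => i _.
exact: hell2_quasi_triangle.
Qed.

Lemma Hdist_triangle t u v : Hdist t v <= Hdist t u + Hdist u v.
Proof.
apply: quasi_triangle_le; rewrite ?Hdist_ge0 // => c c0.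
by rewrite !sqr_Hdist; exact: Hdist2_quasi_triangle.
Qed.

Lemma psi_ratioE t t' i (x : E i) : psi_ratio t t' x = rpsi (t i x) (t' i x).
Proof. by apply: psi_quotE; exact: density_ge0. Qed.

Lemma psi_ratio_measurable t t' i : measurable_fun setT (@psi_ratio _ _ _ _ _ i t t').
Proof.
rewrite (_ : @psi_ratio _ _ _ _ _ i t t' = fun x => rpsi (t i x) (t' i x)).
  exact: rpsi_measurable.
by apply/funext => x; exact: psi_ratioE.
Qed.

Lemma psi_ratio_le1 t t' i (x : E i) : `|psi_ratio t t' x| <= 1.
Proof. by rewrite psi_ratioE rpsi_le1 //; exact: density_ge0. Qed.

Lemma psi_ratioN t t' i (x : E i) : psi_ratio t' t x = - psi_ratio t t' x.
Proof. by rewrite !psi_ratioE /rpsi -mulNr opprB [t' i x + _]addrC. Qed.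

Lemma TstatN (x : forall i, E i) t t' : Tstat x t' t = - Tstat x t t'.
Proof.
rewrite /Tstat opprD -!mulrN -!sumrN; congr (_ * _ + _ * _).
  apply: eq_bigr => i _; rewrite opprB.
  suff -> : (fun y => (t' i y + t i y) / 2) = (fun y => (t i y + t' i y) / 2) by [].
  by apply/funext => y; rewrite addrC.
by apply: eq_bigr => i _; exact: psi_ratioN.
Qed.

Context (d' : measure_display) (Omega : measurableType d')
  (P : densities mu -> probability Omega R) (X : forall i, Omega -> E i).
Hypothesis hPX : density_experiment P X.

Lemma psi_ratio_expectation s t t' (k : nat) i : (0 < k)%N ->
  \int[P s]_w psi_ratio t t' (X i w) ^+ k
  = \int[mu i]_x (s i x * rpsi (t i x) (t' i x) ^+ k).
Proof.
move=> k0; have [mX /(_ s)[_ hs]] := hPX.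
rewrite (density_expectation (mX i) (hs i) (f := fun x => psi_ratio t t' x ^+ k)).
- by apply: eq_Rintegral => x _; rewrite psi_ratioE.
- by apply: measurable_funX; exact: psi_ratio_measurable.
- by move=> x; rewrite normrX exprn_ile1 ?psi_ratio_le1.
Qed.

Lemma ZstatE s t t' w : Zstat P X s t t' w =
  \sum_i (psi_ratio t t' (X i w) - \int[P s]_w' psi_ratio t t' (X i w')).
Proof. by apply: eq_bigr => i _; rewrite unlock. Qed.

Lemma Zstat_measurable s t t' : measurable_fun setT (Zstat P X s t t').
Proof.
rewrite (_ : Zstat _ _ _ _ _ = fun w => \sum_i
  (psi_ratio t t' (X i w) - \int[P s]_w' psi_ratio t t' (X i w'))).
  apply: measurable_sum => i; apply: measurable_funB => //.
  have h := measurableT_comp (psi_ratio_measurable t t' (i := i)) (hPX.1 i).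
  exact: h.
by apply/funext => w; exact: ZstatE.
Qed.

Lemma psi_ratio_second_moment s t t' :
  \sum_i \int[P s]_w psi_ratio t t' (X i w) ^+ 2 <= 6 * (Hdist2 s t + Hdist2 s t').
Proof.
rewrite -big_split mulr_sumr; apply: ler_sum => i _.
by rewrite psi_ratio_expectation // density_rpsi_second_moment.
Qed.

(** [Tstat] is its mean plus [1 / sqrt 2] times [Zstat]; the mean is bounded on each coordinate by
    [density_bias]. *)
Lemma Tstat_le s t t' w :
  Tstat (fun i => X i w) t t' <=
  c2 R * Hdist2 s t - (1 - 1 / Num.sqrt 2) * Hdist2 s t'
  + 1 / Num.sqrt 2 * Zstat P X s t t' w.
Proof.
rewrite ZstatE sumrB mulrBr.
have : 1 / 2 * (\sum_(i < n) (affinity (mu i) (t' i) (fun x => (t i x + t' i x) / 2)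
      - affinity (mu i) (t i) (fun x => (t i x + t' i x) / 2)))
    + 1 / Num.sqrt 2 * \sum_i \int[P s]_w' psi_ratio t t' (X i w') <=
    c2 R * Hdist2 s t - (1 - 1 / Num.sqrt 2) * Hdist2 s t'.
  rewrite /Hdist2 !mulr_sumr -sumrB -big_split; apply: ler_sum => i _ /=.
  have := @psi_ratio_expectation s t t' 1 i isT.
  under eq_Rintegral do rewrite expr1.
  move=> ->; under eq_Rintegral do rewrite expr1.
  exact: density_bias.
rewrite /Tstat /=; lra.
Qed.

End ProductExperiment.

(** * Deviations over nets *)

Section Countability.

Lemma countable_range (T : Type) (A : set T) :
  countable A -> A !=set0 -> exists f : nat -> T, range f = A.
Proof.
move=> /countable_injP[g ginj] [t0 At0].
pose f k := if pselect (exists t, A t /\ g t = k) is left h then sval (cid h) else t0.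
have fA k : A (f k).
  by rewrite /f; case: pselect => // h; case: cid => t [].
exists f; apply/seteqP; split=> [t [k _ <-]|t At]; first exact: fA.
exists (g t) => //; rewrite /f; case: pselect => [h|]; last by case; exists t.
by case: cid => u [/= Au gu]; apply: ginj; rewrite ?inE.
Qed.

Context {R : realType} d (Omega : measurableType d) (Q : probability Omega R).

Lemma countable_bigcup_measurable (T : Type) (A : set T) (F : T -> set Omega) :
  countable A -> (forall i, A i -> measurable (F i)) ->
  measurable (\bigcup_(i in A) F i).
Proof.
move=> cA mF; have [->|/set0P A0] := eqVneq A set0; first by rewrite bigcup_set0.
have [f fA] := countable_range cA A0.
rewrite -fA bigcup_image; apply: bigcup_measurable => k _.
by apply: mF; rewrite -fA; exists k.
Qed.

(** The index set is carried into [nat] by an injection [g], where countable subadditivity applies;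
    [F' k] is empty when [k] is not a value of [g]. *)
Lemma probability_bigcup_esum (T : choiceType) (A : set T) (F : T -> set Omega) :
  countable A -> (forall i, A i -> measurable (F i)) ->
  (Q (\bigcup_(i in A) F i) <= \esum_(i in A) Q (F i))%E.
Proof.
move=> cA mF; have mU := countable_bigcup_measurable cA mF.
have /countable_injP[g ginj] := cA.
pose F' k := \bigcup_(i in A `&` [set i | g i = k]) F i.
have mF' k : measurable (F' k).
  apply: countable_bigcup_measurable => [|i [Ai _]]; last exact: mF.
  by apply: sub_countable cA; apply: subset_card_le => i [].
apply: (@le_trans _ _ (\sum_(k <oo) Q (F' k))%E).
  apply: measure_sigma_subadditive => // w [i Ai Fiw].
  by exists (g i) => //; exists i.
rewrite nneseries_esumT //.
have -> : (\esum_(i in A) Q (F i) = \esum_(i in A) Q (F' (g i)))%E.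
  apply: eq_esum => i Ai; congr (Q _); apply/seteqP; split=> [w Fw|w [j [Aj gji] Fjw]].
    by exists i.
  by rewrite (_ : i = j) //; apply: ginj; rewrite ?inE.
rewrite -(@esum_image _ _ _ A g (fun k => Q (F' k)) ginj) [leRHS]esum_mkcond.
apply: le_esum => k _; case: ifPn => // /negP kA.
rewrite (_ : F' k = set0) ?measure0 //.
rewrite -subset0 => w [i [Ai gi] _]; apply: kA; rewrite inE.
by exists i.
Qed.

End Countability.

(** * Deviation of the supremum over a ball of a countable set *)

Section Deviation.
Context {R : realType} (n : nat) (d : 'I_n -> measure_display)
  (E : forall i, measurableType (d i))
  (mu : forall i, {measure set (E i) -> \bar R}).
Context (d' : measure_display) (Omega : measurableType d')
  (P : densities mu -> probability Omega R) (X : forall i, Omega -> E i).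
Hypothesis hPX : density_experiment P X.
Context (s sb : densities mu).

Let Z t := Zstat P X s sb t.

(** The Chernoff bound at [lam = 1 / 300] for a supremum of mean at most [W] with second moments
    summing to at most [6 z], whence [6 / 100]. *)
Definition deviation_bound (z W r : R) : R :=
  expR (- (1 / 300 * (r - (27 / 25 * W + 6 / 100 * z)))).

Lemma measurable_gt (r : R) t : measurable [set w | r < `|Z t w|].
Proof.
rewrite -[X in measurable X]setTI; apply: measurable_fun_ltr => //.
exact/measurable_funnorm/Zstat_measurable.
Qed.

Lemma finite_deviation (T : finType) (t0 : T) (f : T -> densities mu) (z W r : R) :
  (forall t, Hdist2 s (f t) + Hdist2 s sb <= z) ->
  (\int[P s]_w (maxabs t0 (fun t => Z (f t) w))%:E <= W%:E)%E ->
  (P s [set w | (r < maxabs t0 (fun t => Z (f t) w))%R] <=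
   (deviation_bound z W r)%:E)%E.
Proof.
move=> hz hW; have [mX hs] := hPX; have [hind _] := hs s.
pose g i t (x : E i) := psi_ratio sb (f t) x.
pose Zm w := maxabs t0 (fun t => Z (f t) w).
have eZ : Zm =
  (fun w => maxabs t0 (fun t => \sum_i (g i t (X i w) - \int[P s]_w' g i t (X i w')))).
  by apply/funext => w; congr maxabs; apply/funext => t; rewrite /Z ZstatE.
have mg i t : measurable_fun setT (@g i t) by exact: psi_ratio_measurable.
have gb i t x : `|@g i t x| <= 1 by exact: psi_ratio_le1.
have hv t : \sum_i \int[P s]_w g i t (X i w) ^+ 2 <= 6 * z.
  apply: le_trans (psi_ratio_second_moment hPX s sb (f t)) _.
  by rewrite ler_wpM2l // addrC.
have main : \int[P s]_w expR (1 / 300 * Zm w) <=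
    expR (1 / 300 * (27 / 25 * \int[P s]_w Zm w + 1 / 100 * (6 * z))).
  by rewrite eZ; exact: exp_maxabs_deviation_le.
have iZ : (P s).-integrable setT (EFin \o Zm).
  by rewrite eZ; exact: maxabs_deviation_integrable.
rewrite /deviation_bound.
have l0 : 0 <= 1 / 300 :> R by lra.
move: (1 / 300 : R) l0 main => lam l0 main.
have iexpZ : (P s).-integrable setT (EFin \o (fun w => expR (lam * Zm w))).
  by rewrite eZ; apply: exp_maxabs_deviation_integrable.
have EZ : \int[P s]_w Zm w <= W.
  by rewrite -lee_fin /Rintegral fineK //; exact: integrable_fin_num.
set A := [set w | _].
have mA : measurable A.
  rewrite -[X in measurable X]setTI; apply: measurable_fun_ltr => //.
  apply: (@measurable_maxabs _ _ _ _ t0 (fun t => Z (f t))) => t.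
  exact: Zstat_measurable.
have h1 : ((expR (lam * r))%:E * P s A <=
    (\int[P s]_w expR (lam * Zm w))%:E)%E.
  rewrite /Rintegral fineK; last exact: integrable_fin_num.
  rewrite -[A in P s A]setIT -(integral_indic _ measurableT mA) -ge0_integralZl //=.
  - apply: ge0_le_integral => //.
    + apply/measurable_EFinP; apply: measurable_funM => //; exact: measurable_indic.
    + by have := measurable_int _ iexpZ.
    + move=> w _; rewrite -EFinM lee_fin indicE.
      have [wA|_] := boolP (w \in A); last by rewrite mulr0 expR_ge0.
      rewrite mulr1 ler_expR ler_wpM2l //.
      by rewrite inE in wA; exact: ltW.
  - by apply/measurable_EFinP; exact: measurable_indic.
have PA : P s A \is a fin_num by rewrite fin_num_measure.
rewrite -(fineK PA) -EFinM lee_fin in h1; rewrite -(fineK PA) lee_fin.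
have -> : expR (- (lam * (r - (27 / 25 * W + 6 / 100 * z)))) =
    (expR (lam * r))^-1 * expR (lam * (27 / 25 * W + 6 / 100 * z)).
  by rewrite -expRN -expRD; congr expR; ring.
rewrite ler_pdivlMl ?expR_gt0 //.
apply: le_trans h1 (le_trans main _).
rewrite ler_expR; have := ler_wpM2l l0 EZ; lra.
Qed.

End Deviation.

Lemma esup0_ge {R : realType} (A : set (\bar R)) x : A x -> (x <= esup0 A)%E.
Proof.
rewrite /esup0 => Ax; case: eqP => [A0|_]; last exact: ereal_sup_ubound.
by rewrite A0 in Ax.
Qed.

Section CountableDeviation.
Context {R : realType} (n : nat) (d : 'I_n -> measure_display)
  (E : forall i, measurableType (d i))
  (mu : forall i, {measure set (E i) -> \bar R}).
Context (d' : measure_display) (Omega : measurableType d')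
  (P : densities mu -> probability Omega R) (X : forall i, Omega -> E i).
Hypothesis hPX : density_experiment P X.
Context (s sb : densities mu) (S : set (densities mu)).
Hypothesis cS : countable S.

Let Z t := Zstat P X s sb t.

Lemma Bset_countable y : countable (Bset S s sb y).
Proof. by apply: sub_countable cS; apply: subset_card_le => t []. Qed.

(** Along an enumeration of the ball, the events for the first [k + 1] elements increase to the full
    event, and [finite_deviation] bounds each of them uniformly in [k]. *)
Lemma countable_deviation (y W r : R) :
  (wfun P X S s sb y <= W%:E)%E ->
  (P s (\bigcup_(t in Bset S s sb y) [set w | (r < `|Z t w|)%R]) <=
   (deviation_bound (y ^+ 2) W r)%:E)%E.
Proof.
move=> hW; have [B0|/set0P B0] := eqVneq (Bset S s sb y) set0.
  by rewrite B0 bigcup_set0 measure0 lee_fin expR_ge0.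
have [f fB] := countable_range (Bset_countable y) B0.
have Bf k : Bset S s sb y (f k) by rewrite -fB; exists k.
pose A k := [set w | r < maxabs (@ord0 k) (fun j => Z (f j) w)].
have mM k : measurable_fun setT (fun w => maxabs (@ord0 k) (fun j => Z (f j) w)).
  apply: (@measurable_maxabs _ _ _ _ ord0 (fun j : 'I_k.+1 => Z (f j))) => j.
  exact: Zstat_measurable.
have mA k : measurable (A k).
  by rewrite -[X in measurable X]setTI; apply: measurable_fun_ltr.
have -> : \bigcup_(t in Bset S s sb y) [set w | r < `|Z t w|] = \bigcup_k A k.
  apply/seteqP; split=> w.
    move=> [t]; rewrite -fB => -[k _ <-] /= rk; exists k => //=.
    apply: lt_le_trans rk _.
    exact: (maxf_ge (@ord0 k) (fun j : 'I_k.+1 => `|Z (f j) w|) ord_max).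
  by move=> [k _ rk]; exists (f [arg max_(j > @ord0 k) `|Z (f j) w|]%O).
have ndA : nondecreasing_seq A.
  move=> i j ij; apply/subsetPset => w /= rw; apply: lt_le_trans rw _.
  apply: maxf_le => k.
  exact: (maxf_ge (@ord0 j) (fun k : 'I_j.+1 => `|Z (f k) w|)
    (widen_ord (ij : (i.+1 <= j.+1)%N) k)).
have mUA : measurable (\bigcup_k A k) by apply: bigcup_measurable.
have cvgA := nondecreasing_cvg_mu (mu := P s) mA mUA ndA.
rewrite -(cvg_lim _ cvgA) //; apply: lime_le.
  by apply/cvg_ex; eexists; exact: cvgA.
near=> k; apply: finite_deviation => //.
- by move=> j; have [] := Bf j.
apply: le_trans hW; apply: ge0_le_integral => //.
- by move=> w _; rewrite lee_fin maxabs_ge0.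
- exact/measurable_EFinP/mM.
- rewrite (_ : (fun w => _) = fun w => esups (fun k => `|Z (f k) w|%:E) 0%N).
    apply: measurable_fun_esups => j; apply/measurable_EFinP.
    exact/measurable_funnorm/Zstat_measurable.
  apply/funext => w; rewrite /esup0 ifF; last first.
    by apply/eqP/eqP/set0P; exists `|Z (f 0%N) w|%:E; exists (f 0%N).
  congr ereal_sup; apply/seteqP; split=> x.
    by move=> [t]; rewrite -fB => -[j _ <-] <-; exists j.
  by move=> [j _ <-]; exists (f j).
- move=> w _; rewrite /maxabs /maxf; set j := [arg max_(t > _) _]%O.
  by apply: esup0_ge; exists (f j).
Unshelve. all: by end_near.
Qed.

Lemma measurable_deviation_set (r : densities mu -> R) :
  measurable (\bigcup_(t in S) [set w | r t < `|Z t w|]).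
Proof.
apply: countable_bigcup_measurable => // t _; exact: measurable_gt.
Qed.

End CountableDeviation.

(** * Peeling over geometric levels *)

Section Peeling.
Context {R : realType}.

(** A gain of [3 / 4] in the exponent per level makes the probabilities decrease at least like
    powers of [1 / 2]. *)
Lemma expR34_ge2 : 2 <= expR (3 / 4) :> R.
Proof.
have -> : 3 / 4 = 15%:R * (1 / 20) :> R by field.
rewrite expRM_natl.
have h : (21 / 20) ^+ 15 <= expR (1 / 20) ^+ 15 :> R.
  apply: lerXn2r; rewrite ?nnegrE ?expR_ge0 //.
  by apply: le_trans (expR_ge1Dx _); lra.
apply: le_trans h; lra.
Qed.

Lemma pow32_ge (j : nat) : (0 < j)%N -> 13 / 10 * j%:R - 3 / 5 <= (3 / 2) ^+ j :> R.
Proof.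
case: j => [//|[|[|j]]] _; [rewrite expr1; lra | lra |].
elim: j => [|j IH]; first lra.
rewrite exprS -[j.+4%:R]natr1; have : 3 <= j.+3%:R :> R by rewrite ler_nat.
lra.
Qed.

Lemma pow32_ge_nat (j : nat) : j%:R <= (3 / 2) ^+ j.+1 :> R.
Proof.
case: j => [|j]; first by rewrite exprn_ge0.
have := pow32_ge (isT : (0 < j.+2)%N); rewrite -[j.+2%:R]natr1.
have : 0 <= j.+1%:R :> R by []. lra.
Qed.

Lemma sqrt2_ge : 141 / 100 <= Num.sqrt 2 :> R.
Proof.
have w2 : Num.sqrt 2 ^+ 2 = 2 :> R by rewrite sqr_sqrtr.
have w0 : 0 <= Num.sqrt 2 :> R by exact: sqrtr_ge0.
rewrite -ler_sqr ?nnegrE // w2; lra.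
Qed.

Lemma inv_sqrt2 : 1 / Num.sqrt 2 = Num.sqrt 2 / 2 :> R.
Proof.
have w2 : Num.sqrt 2 ^+ 2 = 2 :> R by rewrite sqr_sqrtr.
have w0 : 0 < Num.sqrt 2 :> R by rewrite sqrtr_gt0.
move: w2 w0; set w := Num.sqrt 2 => w2 w0.
by rewrite -w2; field; rewrite gt_eqF.
Qed.

(* [theta = (1 - 1 / sqrt 2) / sqrt 2]. *)
Definition theta : R := (Num.sqrt 2 - 1) / 2.

(* With [3200], level [0] already absorbs the cost of the union over levels, and
   the gap [theta - 3/2 (27/25 c_0 + 6/100) > 0] pays for the later ones. *)
Definition level (D : R) (j : nat) : R := (3 / 2) ^+ j.+1 * (D + 32 * 100).

(** Divided by [sqrt 2] and taken at [tau = Delta Sb + xi], this is the term of [pen1] for the net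
    plus [kappa (xi + 7/5)]. *)
Definition excess (D tau : R) : R := Num.sqrt 2 * (D / 8 + kappa R * (tau + 7 / 5)).

(** An element first reached at level [j > 0] has [theta v > theta * level D (j - 1)]; level [0] has
    no such gain. *)
Definition level_threshold (D tau : R) (j : nat) : R :=
  (if j is j'.+1 then theta * level D j' else 0) + excess D tau.

Lemma level_deviation_bound (D tau : R) (j : nat) : 1 <= D -> 0 <= tau ->
  deviation_bound (level D j) (c0 R * level D j) (level_threshold D tau j)
  <= expR (- tau) / (2 ^ j.+1)%:R.
Proof.
move=> D1 t0; have w1 := sqrt2_ge.
have hX : tau + 3 / 4 * j.+1%:R <= 1 / 300 * (level_threshold D tau j
    - (27 / 25 * (c0 R * level D j) + 6 / 100 * level D j)).
  rewrite /level_threshold /excess /theta /c0 inv_sqrt2 /kappa.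
  move: (Num.sqrt 2) w1 => w w1.
  have wD := ler_wpM2r (le_trans ler01 D1) w1.
  have wt := ler_wpM2r t0 w1.
  case: j => [|j].
    (* Level [0]: [sqrt 2 / 8] exceeds [3/2 (27/25 c_0 + 6/100)], the factor of [D], and
       [7/5 sqrt 2 kappa] covers both the constant [3200] with that factor and the required
       [300 * 3/4]. *)
    rewrite /level expr1; lra.
  have hj := pow32_ge (isT : (0 < j.+1)%N).
  have -> : level D j.+1 = 3 / 2 * level D j by rewrite /level exprS mulrA.
  have hl : 32 * 100 * (3 / 2) ^+ j.+1 <= level D j.
    by rewrite /level mulrC ler_wpM2l ?exprn_ge0 // lerDr (le_trans ler01).
  rewrite -[j.+2%:R]natr1; move: (level D j) hl => L hl.
  have L0 : 0 <= L by apply: le_trans hl; rewrite mulr_ge0 // exprn_ge0.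
  have wL := ler_wpM2r L0 w1.
  have k0 : 0 <= j.+1%:R :> R by [].
  move: ((3 / 2) ^+ j.+1) (j.+1%:R) hj hl k0 => p k hj hl k0; lra.
rewrite /deviation_bound.
apply: (@le_trans _ _ (expR (- (tau + 3 / 4 * j.+1%:R)))).
  by rewrite ler_expR lerN2.
rewrite opprD expRD ler_wpM2l ?expR_ge0 // expRN lef_pV2 ?posrE ?expR_gt0 //.
rewrite natrX expRM_natr; apply: lerXn2r; rewrite ?nnegrE ?expR_ge0 //.
exact: expR34_ge2.
Qed.

Context (n : nat) (d : 'I_n -> measure_display)
  (E : forall i, measurableType (d i))
  (mu : forall i, {measure set (E i) -> \bar R}).
Context (d' : measure_display) (Omega : measurableType d')
  (P : densities mu -> probability Omega R) (X : forall i, Omega -> E i).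
Hypothesis hPX : density_experiment P X.
Context (s sb : densities mu) (S : set (densities mu)) (D : R).
Hypothesis cS : countable S.
Hypothesis D1 : 1 <= D.
Hypothesis hD : (dimension P X S s sb <= D%:E)%E.

(** Beyond the critical radius [ybar] the inequality defining it fails. *)
Lemma wfun_le (y : R) : 0 <= y -> D < y ^+ 2 ->
  (wfun P X S s sb y <= (c0 R * y ^+ 2)%:E)%E.
Proof.
move=> y0 Dy; rewrite leNgt; apply/negP => hw.
have : ((y ^+ 2)%:E <= D%:E)%E.
  apply: le_trans hD; apply: (@le_trans _ _ (ybar P X S s sb ^+ 2)%E); last first.
    by rewrite /dimension le_max lexx.
  have hy : (y%:E <= ybar P X S s sb)%E by apply: esup0_ge; exists y.
  rewrite EFin_expe expe2 [leRHS]expe2; apply: lee_pmul => //; by rewrite lee_fin.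
by rewrite lee_fin leNgt Dy.
Qed.

Lemma peeling (tau : R) : 0 <= tau ->
  (P s (\bigcup_(t in S) [set w |
     (theta * (Hdist2 s t + Hdist2 s sb) + excess D tau < `|Zstat P X s sb t w|)%R])
   <= (expR (- tau))%:E)%E.
Proof.
move=> t0; have w1 := sqrt2_ge.
have th0 : 0 <= theta by rewrite /theta; lra.
pose F j := \bigcup_(t in Bset S s sb (Num.sqrt (level D j)))
  [set w | level_threshold D tau j < `|Zstat P X s sb t w|].
have D0 : 0 <= D := le_trans ler01 D1.
have lev0 j : 0 <= level D j.
  by rewrite /level mulr_ge0 ?exprn_ge0 ?addr_ge0 ?mulr_ge0.
have mF j : measurable (F j).
  apply: measurable_deviation_set => //; exact: Bset_countable.
apply: (@le_trans _ _ (\sum_(j <oo) P s (F j))%E).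
  apply: measure_sigma_subadditive => //.
    exact: measurable_deviation_set.
  move=> w [t St /= hw]; set v := Hdist2 s t + Hdist2 s sb in hw.
  have v0 : 0 <= v by rewrite addr_ge0 ?Hdist2_ge0.
  have exj : exists j, v <= level D j.
    exists (Num.truncn v).+1; have /andP[_ h] := truncn_itv v0.
    apply: le_trans (ltW h) _; apply: le_trans (pow32_ge_nat _) _.
    by rewrite /level ler_peMr ?exprn_ge0 //; lra.
  (* Minimality of [j] gives [v > level D (j - 1)], so the threshold of level [j] is below the
     threshold in [hw]. *)
  have [j hj jmin] := ex_minnP exj.
  exists j => //; exists t.
    by split=> //; rewrite sqr_sqrtr.
  rewrite /=; apply: le_lt_trans hw; rewrite /level_threshold lerD2r.
  case: j hj jmin => [_ _|j hj jmin]; first by rewrite mulr_ge0.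
  rewrite ler_wpM2l // leNgt; apply/negP => lv.
  by have := jmin j (ltW lv); rewrite ltnn.
apply: le_trans (epsilon_trick0 xpredT (expR_ge0 (- tau))).
apply: lee_nneseries => // j _.
apply: le_trans (countable_deviation hPX cS (W := c0 R * level D j) _ _) _.
  rewrite -{2}(sqr_sqrtr (lev0 j)); apply: wfun_le; first exact: sqrtr_ge0.
  rewrite sqr_sqrtr //; apply: (@lt_le_trans _ _ (D + 32 * 100)).
    by rewrite ltrDl mulr_gt0.
  rewrite /level ler_peMl ?addr_ge0 ?mulr_ge0 // exprn_ege1 //; lra.
by rewrite lee_fin sqr_sqrtr // level_deviation_bound.
Qed.

End Peeling.

(** * The oracle inequality *)

Section ModelSelection.
Context {R : realType} (n : nat) (d : 'I_n -> measure_display)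
  (E : forall i, measurableType (d i))
  (mu : forall i, {measure set (E i) -> \bar R}).
Context (d' : measure_display) (Omega : measurableType d')
  (P : densities mu -> probability Omega R) (X : forall i, Omega -> E i).
Hypothesis hPX : density_experiment P X.
Context (models : set (set (densities mu))) (Delta : set (densities mu) -> R)
  (net : set (densities mu) -> set (densities mu)) (pen : densities mu -> R).
Hypothesis hmodels_countable : countable models.
Hypothesis hDelta_ge0 : forall Sb, models Sb -> 0 <= Delta Sb.
Hypothesis hDelta : (\esum_(Sb in models) (expR (- Delta Sb))%:E <= 1)%E.
Hypothesis hnet_countable : forall Sb, models Sb -> countable (net Sb).

Let bS := \bigcup_(Sb in models) net Sb.

Hypothesis hpen : forall t, bS t -> (pen1 P X models Delta net t <= (pen t)%:E)%E.

Lemma dimension_le_max (S : set (densities mu)) s sb :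
  (dimension P X S s sb <= max_dimension P X S)%E.
Proof. by apply: esup0_ge; exists (s, sb). Qed.

Lemma max_dimension_ge1 (S : set (densities mu)) (s : densities mu) :
  (1 <= max_dimension P X S)%E.
Proof.
by apply: le_trans (dimension_le_max S s s); rewrite /dimension le_max lexx orbT.
Qed.

Section FixedPoint.
Context (s sb : densities mu) (xi : R).
Hypothesis xi0 : 0 < xi.
Hypothesis sbS : bS sb.

(** A net of infinite dimension contributes [+oo] to the infimum [pen1], so that no control is
    required from it and its event is taken empty. *)
Let bad Sb : set Omega :=
  if max_dimension P X (net Sb) == +oo%E then set0 else
  \bigcup_(t in net Sb) [set w |
     theta * (Hdist2 s t + Hdist2 s sb)
     + excess (fine (max_dimension P X (net Sb))) (Delta Sb + xi)
     < `|Zstat P X s sb t w|].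

Let measurable_bad Sb : models Sb -> measurable (bad Sb).
Proof.
move=> mSb; rewrite /bad; case: ifP => // _.
by apply: measurable_deviation_set => //; exact: hnet_countable.
Qed.

Let max_dimensionE Sb : max_dimension P X (net Sb) != +oo%E ->
  (fine (max_dimension P X (net Sb)))%:E = max_dimension P X (net Sb).
Proof.
move=> h; apply: fineK; rewrite ge0_fin_numE ?ltey //.
exact: le_trans (max_dimension_ge1 _ s).
Qed.

Let bad_le Sb : models Sb ->
  (P s (bad Sb) <= (expR (- xi))%:E * (expR (- Delta Sb))%:E)%E.
Proof.
move=> mSb; rewrite /bad; case: ifPn => [_|hfin].
  by rewrite measure0 mule_ge0 // lee_fin expR_ge0.
rewrite -EFinM -expRD -opprD addrC; apply: peeling => //.
- exact: hnet_countable.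
- by rewrite -lee_fin max_dimensionE //; exact: max_dimension_ge1.
- by rewrite max_dimensionE // dimension_le_max.
- by rewrite addr_ge0 ?hDelta_ge0 // ltW.
Qed.

Let all_bad := \bigcup_(Sb in models) bad Sb.

Let measurable_all_bad : measurable all_bad.
Proof. exact: countable_bigcup_measurable hmodels_countable measurable_bad. Qed.

Let all_bad_le : (P s all_bad <= (expR (- xi))%:E)%E.
Proof.
apply: le_trans (probability_bigcup_esum (P s) hmodels_countable measurable_bad) _.
apply: le_trans (le_esum bad_le) _.
(* The factor [expR (- xi)] is taken out of each finite partial sum; the weights left over sum to at
   most [1]. *)
apply: ge_ereal_sup => _ [A Am <-].
rewrite -ge0_mule_fsumr; last by move=> Sb; rewrite lee_fin expR_ge0.
rewrite -[leRHS]mule1; apply: lee_wpmul2l; first by rewrite lee_fin expR_ge0.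
apply: le_trans hDelta; apply: ereal_sup_ubound; by exists A.
Qed.

Let a : R := 1 - 1 / Num.sqrt 2.

(** Division by [sqrt 2] turns [theta] into [a / 2] and [excess] into a term of [pen1] plus
    [kappa (xi + 7/5)]. The bound holds for every net containing [t], hence with the infimum [pen1]
    and then with [pen]. *)
Let good_deviation w t : ~ all_bad w -> bS t ->
  1 / Num.sqrt 2 * `|Zstat P X s sb t w| <=
  a / 2 * (Hdist2 s t + Hdist2 s sb) + pen t + kappa R * (xi + 7 / 5).
Proof.
move=> good tS; rewrite /a inv_sqrt2.
set z := `|_|; set v := Hdist2 s t + _.
set w2 := Num.sqrt 2 / 2.
suff key : ((w2 * z - (1 - w2) / 2 * v - kappa R * (xi + 7 / 5))%:E <= (pen t)%:E)%E.
  by rewrite lee_fin in key; lra.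
apply: le_trans (hpen tS); apply: le_ereal_inf_tmp => _ [Sb [mSb St] <-].
have [e|fin] := eqVneq (max_dimension P X (net Sb)) +oo%E.
  by rewrite e gt0_muley ?lte_fin // addye ?leey.
have zle : z <= theta * v + excess (fine (max_dimension P X (net Sb))) (Delta Sb + xi).
  rewrite leNgt; apply/negP => h; apply: good; exists Sb => //.
  by rewrite /bad (negbTE fin); exists t.
rewrite -(max_dimensionE fin) -EFinM -EFinD lee_fin.
move: (fine _) zle => D; rewrite /theta /excess /w2 => zle.
have ww : Num.sqrt 2 * Num.sqrt 2 = 2 :> R by rewrite -expr2 sqr_sqrtr.
have := ler_wpM2l (sqrtr_ge0 (2 : R)) zle.
move: (Num.sqrt 2) ww (kappa R) (Delta Sb) => r ww k De.
have -> : r * ((r - 1) / 2 * v + r * (D / 8 + k * (De + xi + 7 / 5))) =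
  (r * r - r) / 2 * v + r * r * (D / 8 + k * (De + xi + 7 / 5)) by field.
rewrite ww; lra.
Qed.

Definition oracle_bound : R :=
  c1 R * Hdist2 s sb + 8 * c2 R * pen sb + c3 R * (145 / 100 + xi).

Let good_estimator w st : ~ all_bad w ->
  rho_estimators (fun i => X i w) bS pen st -> Hdist2 s st <= oracle_bound.
Proof.
move=> good [stS hst].
pose x i := X i w; pose K := kappa R * (xi + 7 / 5).
have dev t : bS t -> 1 / Num.sqrt 2 * Zstat P X s sb t w <=
    a / 2 * (Hdist2 s t + Hdist2 s sb) + pen t + K.
  move=> tS; apply: le_trans (good_deviation good tS).
  by rewrite ler_wpM2l ?ler_norm // divr_ge0 ?sqrtr_ge0.
(* Half of the negative bias [- a h^2(s, t)] absorbs the fluctuation term. *)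
have T_le t : bS t -> Tstat x sb t - pen t <=
    (c2 R + a / 2) * Hdist2 s sb - a / 2 * Hdist2 s t + K.
  move=> tS; have := dev t tS; have := Tstat_le hPX s sb t w.
  rewrite -/x -/a; lra.
have a0 : 0 < a.
  rewrite /a subr_gt0 ltr_pdivrMr ?sqrtr_gt0 // mul1r.
  by have := @sqrt2_ge R; lra.
have up : (Upsilon x bS pen sb <= ((c2 R + a / 2) * Hdist2 s sb + K + pen sb)%:E)%E.
  rewrite /Upsilon EFinD leeD2r //; apply: ge_ereal_sup => _ [t tS <-].
  rewrite lee_fin; apply: le_trans (T_le t tS) _.
  by rewrite lerD2r gerBl mulr_ge0 ?Hdist2_ge0 // divr_ge0 // ltW.
have low : ((Tstat x st sb - pen sb + pen st)%:E <= Upsilon x bS pen st)%E.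
  by rewrite /Upsilon EFinD leeD2r //; apply: ereal_sup_ubound; exists sb.
have : (Upsilon x bS pen st <= Upsilon x bS pen sb + (kappa R / 10)%:E)%E.
  apply: le_trans hst _; rewrite leeD2r //; apply: ereal_inf_lbound.
  by exists sb.
move=> /(le_trans low)/le_trans => /(_ _ (leeD2r _ up)).
(* Antisymmetry produces [- Tstat x sb st], to which [T_le] applies a second time. *)
rewrite -EFinD lee_fin TstatN => h.
have hb : a / 2 * Hdist2 s st <= 2 * (c2 R + a / 2) * Hdist2 s sb + 2 * pen sb
    + 2 * K + kappa R / 10.
  by have := T_le st stS; lra.
have ww : Num.sqrt 2 * Num.sqrt 2 = 2 :> R by rewrite -expr2 sqr_sqrtr.
(* Hence multiplication by [4 c_2] isolates [h^2(s, st)], with [c_1 = 8 c_2^2 + 2]. The constant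
   [145/100] is [7/5 + 1/20], where [1/20] comes from the slack [kappa / 10] of the estimator. *)
have c2a : 2 * c2 R * a = 1.
  rewrite /c2 /a inv_sqrt2; transitivity (2 - Num.sqrt 2 * Num.sqrt 2 / 2 : R).
    by field.
  by rewrite ww; field.
have c20 : 0 <= c2 R by rewrite /c2 addr_ge0 // divr_ge0 ?sqrtr_ge0.
have -> : Hdist2 s st = 4 * c2 R * (a / 2 * Hdist2 s st).
  transitivity (2 * c2 R * a * Hdist2 s st); last by field.
  by rewrite c2a mul1r.
apply: le_trans (ler_wpM2l (mulr_ge0 (ler0n R 4) c20) hb) _.
rewrite le_eqVlt; apply/orP; left; apply/eqP; rewrite /oracle_bound.
have -> : c1 R = 8 * (c2 R * c2 R) + 2 * (2 * c2 R * a) :> R.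
  rewrite c2a /c1 /c2 inv_sqrt2.
  transitivity (8 + 8 * Num.sqrt 2 + 2 * (Num.sqrt 2 * Num.sqrt 2) + 2 : R); last by field.
  by rewrite ww; ring.
rewrite /c3 /K; move: (kappa R) (c2 R) => k c; by field.
Qed.

Let oracle_bound_ge0 : 0 < pen sb -> 0 <= oracle_bound.
Proof.
move=> p0.
have s0 : 0 <= Num.sqrt 2 :> R := sqrtr_ge0 _.
have c20 : 0 <= c2 R by rewrite /c2 addr_ge0 // divr_ge0.
rewrite /oracle_bound !addr_ge0 //.
- by rewrite mulr_ge0 ?Hdist2_ge0 // /c1 mulr_ge0 // addr_ge0 ?mulr_ge0.
- by rewrite !mulr_ge0 // ltW.
- have k0 : 0 <= kappa R by exact: ler0n.
  rewrite /c3; move: (kappa R) (c2 R) k0 c20 => k c k0 c20.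
  by rewrite mulr_ge0 ?mulr_ge0 // addr_ge0 ?divr_ge0 // ltW.
Qed.

Let good_closure w t : 0 < pen sb -> ~ all_bad w ->
  Hclosure (rho_estimators (fun i => X i w) bS pen) t -> Hdist2 s t <= oracle_bound.
Proof.
move=> p0 good ht; have b0 := oracle_bound_ge0 p0.
rewrite -sqr_Hdist -[leRHS]sqr_sqrtr // ler_sqr ?nnegrE ?Hdist_ge0 ?sqrtr_ge0 //.
apply/ler_addgt0Pr => e e0.
have : (Hdist_set t (rho_estimators (fun i => X i w) bS pen) < e%:E)%E.
  by rewrite ht lte_fin.
move=> /ereal_inf_lt[_ [u uE <-]]; rewrite lte_fin => tu.
apply: le_trans (Hdist_triangle s u t) _; apply: lerD; last by rewrite HdistC ltW.
rewrite -ler_sqr ?nnegrE ?Hdist_ge0 ?sqrtr_ge0 // sqr_Hdist sqr_sqrtr //.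
exact: good_estimator uE.
Qed.

(** The bad event depends on [sb], so [sb] is fixed here. The measurable event [A] is left free in
    order to approach the infimum over [sb] afterwards. *)
Lemma oracle_probability (shat : Omega -> densities mu) (A : set Omega) :
  0 < pen sb ->
  (forall w, Hclosure (rho_estimators (fun i => X i w) bS pen) (shat w)) ->
  measurable A -> (forall w, Hdist2 s (shat w) <= oracle_bound -> A w) ->
  ((1 - expR (- xi))%:E <= P s A)%E.
Proof.
move=> p0 hs mA hA; apply: (@le_trans _ _ (P s (~` all_bad))).
  rewrite probability_setC // EFinB; exact: leeB.
apply: le_measure; rewrite ?inE //; first exact: measurableC.
by move=> w good; apply: hA; exact: good_closure (hs w).
Qed.

End FixedPoint.
End ModelSelection.

(** * Infimum over the nets and comparison with the dimension of the models *)

Section Selection.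
Context {R : realType} (n : nat) (d : 'I_n -> measure_display)
  (E : forall i, measurableType (d i))
  (mu : forall i, {measure set (E i) -> \bar R}).
Implicit Types (s t u : densities mu) (S : set (densities mu)).

(** The complement of a closed ball is open by the triangle inequality. The bound [b] is extended
    because the right-hand sides of the risk bounds can be infinite. *)
Lemma Hmeasurable_ball (d' : measure_display) (Omega : measurableType d')
    (shat : Omega -> densities mu) s (b : \bar R) :
  Hmeasurable shat -> measurable [set w | ((Hdist2 s (shat w))%:E <= b)%E].
Proof.
move=> hs; case: b => [b| |].
- rewrite -[X in measurable X]setCK; apply: measurableC.
  rewrite (_ : ~` _ = shat @^-1` [set t | b < Hdist2 s t]); last first.
    by apply/seteqP; split=> w /=; rewrite lee_fin; [move=> /negP; rewrite -ltNge|
      move=> h; apply/negP; rewrite -ltNge].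
  apply: hs => t /= bt; have [b0|b0] := ltP b 0.
    by exists 1 => // u _ /=; apply: lt_le_trans b0 (Hdist2_ge0 _ _).
  exists (Hdist s t - Num.sqrt b) => [|u /= tu].
    by rewrite subr_gt0 ltr_sqrt // (le_lt_trans b0).
  have : Num.sqrt b < Hdist s u.
    move: tu (Hdist_triangle s u t); rewrite (HdistC u t).
    by move: (Hdist s t) (Hdist s u) (Hdist t u) (Num.sqrt b) => x y z r; lra.
  move=> h; rewrite -(sqr_sqrtr b0) -sqr_Hdist.
  by move: (sqrtr_ge0 b) (Hdist_ge0 s u) h; move: (Num.sqrt b) (Hdist s u) => x y x0 y0;
    rewrite ltr_sqr.
- rewrite (_ : [set w | _] = setT); first exact: measurableT.
  by apply/seteqP; split=> w //= _; rewrite leey.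
- rewrite (_ : [set w | _] = set0); first exact: measurable0.
  by apply/seteqP; split=> w //=; rewrite leeNy_eq.
Qed.

Lemma Hdist_set_ge0 t S : (0 <= Hdist_set t S)%E.
Proof. by apply: le_ereal_inf_tmp => _ [u _ <-]; rewrite lee_fin Hdist_ge0. Qed.

Lemma Hdist_set2_ge0 t S : (0 <= Hdist_set2 t S)%E.
Proof. by rewrite /Hdist_set2 expe2 mule_ge0 ?Hdist_set_ge0. Qed.

Lemma Hdist_set2_adherent t S (q : R) : (Hdist_set2 t S <= q%:E)%E ->
  forall e : R, 0 < e -> exists2 u, S u & Hdist2 t u <= q + e.
Proof.
move=> hq e e0; have q0 : 0 <= q by rewrite -lee_fin (le_trans (Hdist_set2_ge0 t S)).
have : (Hdist_set t S < (Num.sqrt (q + e))%:E)%E.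
  rewrite ltNge; apply/negP => h; have : ((q + e)%:E <= q%:E)%E.
    apply: le_trans hq; rewrite -[(q + e)%R]sqr_sqrtr ?addr_ge0 ?(ltW e0) //.
    rewrite EFin_expe /Hdist_set2 !expe2; apply: lee_pmul => //;
      by rewrite lee_fin sqrtr_ge0.
  by rewrite lee_fin gerDl leNgt e0.
move=> /ereal_inf_lt[_ [u Su <-]]; rewrite lte_fin => tu; exists u => //.
rewrite -sqr_Hdist -[leRHS]sqr_sqrtr ?addr_ge0 ?(ltW e0) //.
by rewrite lerXn2r ?nnegrE ?Hdist_ge0 ?sqrtr_ge0 // ltW.
Qed.

Lemma c1_ge0 : 0 <= c1 R.
Proof. by rewrite /c1 mulr_ge0 // addr_ge0 // mulr_ge0 ?sqrtr_ge0. Qed.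

Lemma c2_gt0 : 0 < c2 R.
Proof. by rewrite /c2 ltr_wpDr // divr_ge0 ?sqrtr_ge0. Qed.

Lemma esup0_Hdist_set2_ge0 S S' : (0 <= esup0 [set Hdist_set2 u S | u in S'])%E.
Proof.
rewrite /esup0; case: eqP => // /eqP/set0P[x [u Su ux]].
by apply: le_trans (Hdist_set2_ge0 u S) _; apply: ereal_sup_ubound; exists u.
Qed.

Context (d' : measure_display) (Omega : measurableType d')
  (P : densities mu -> probability Omega R) (X : forall i, Omega -> E i).
Hypothesis hPX : density_experiment P X.
Context (models : set (set (densities mu))) (Delta : set (densities mu) -> R)
  (net : set (densities mu) -> set (densities mu)) (pen : densities mu -> R).
Hypothesis hmodels_countable : countable models.
Hypothesis hmodels : forall Sb, models Sb -> Sb !=set0.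
Hypothesis hDelta_ge0 : forall Sb, models Sb -> 0 <= Delta Sb.
Hypothesis hDelta : (\esum_(Sb in models) (expR (- Delta Sb))%:E <= 1)%E.
Hypothesis hnet_countable : forall Sb, models Sb -> countable (net Sb).

Let bS := \bigcup_(Sb in models) net Sb.
Hypothesis pen_gt0 : forall t, bS t -> 0 < pen t.

Definition oracle s : \bar R :=
  ereal_inf [set (c1 R * Hdist2 s sb + 8 * c2 R * pen sb)%:E | sb in bS].

(** The exceptional event varies with [sb], so one event cannot serve the whole infimum. For each
    [k] a deterministic near-minimizer bounds the probability of [A k], whose radius is enlarged by
    [1 / (k + 1)], and the [A k] decrease to the target event. *)
Lemma oracle_inequality (shat : Omega -> densities mu) s (xi : R) :
  (forall t, bS t -> (pen1 P X models Delta net t <= (pen t)%:E)%E) ->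
  Hmeasurable shat ->
  (forall w, Hclosure (rho_estimators (fun i => X i w) bS pen) (shat w)) ->
  0 < xi ->
  ((1 - expR (- xi))%:E <= P s [set w | (Hdist2 s (shat w))%:E <=
     oracle s + (c3 R * (145 / 100 + xi))%:E])%E.
Proof.
move=> hpen hs hcl xi0; have [S0|/set0P[t0 St0]] := eqVneq bS set0.
  rewrite (_ : [set w | _] = setT).
    by rewrite [leRHS](@probability_setT _ _ _ (P s)) lee_fin gerBl expR_ge0.
  apply/seteqP; split=> // w _ /=.
  by rewrite /oracle S0 image_set0 ereal_inf0 addye // leey.
have fin : oracle s \is a fin_num.
  rewrite ge0_fin_numE.
    apply: le_lt_trans (ltry (c1 R * Hdist2 s t0 + 8 * c2 R * pen t0)).
    by apply: ereal_inf_lbound; exists t0.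
  apply: le_ereal_inf_tmp => _ [t St <-]; rewrite lee_fin addr_ge0 //.
    by rewrite mulr_ge0 ?Hdist2_ge0 ?c1_ge0.
  by rewrite !mulr_ge0 ?ltW ?c2_gt0 ?pen_gt0.
set c := c3 R * _.
pose A (k : nat) := [set w | ((Hdist2 s (shat w))%:E <=
  (fine (oracle s) + c + k.+1%:R^-1)%:E)%E].
have mA k : measurable (A k) by exact: Hmeasurable_ball.
have -> : [set w | ((Hdist2 s (shat w))%:E <= oracle s + c%:E)%E] = \bigcap_k A k.
  rewrite -(fineK fin) -EFinD; apply/seteqP; split=> w /=.
    by move=> h k _; apply: le_trans h _; rewrite lee_fin lerDl.
  move=> h; rewrite lee_fin; apply/ler_addgt0Pr => e e0.
  have ei : 0 <= e^-1 by rewrite invr_ge0 ltW.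
  have /andP[_ hk] := truncn_itv ei.
  have := h (Num.truncn e^-1) I; rewrite /A /= lee_fin => /le_trans; apply.
  rewrite lerD2l invf_ple ?posrE ?ltr0n //; exact: ltW.
have niA : nonincreasing_seq A.
  move=> i j ij; apply/subsetPset => w /= h; apply: le_trans h _.
  by rewrite lee_fin lerD2l lef_pV2 ?posrE // ler_nat.
have mIA : measurable (\bigcap_k A k) by apply: bigcapT_measurable.
have A0 : (P s (A 0%N) < +oo)%E by rewrite ltey_eq fin_num_measure.
have cvgA := nonincreasing_cvg_mu (mu := P s) A0 mA mIA niA.
rewrite -(cvg_lim _ cvgA) //; apply: lime_ge.
  by apply/cvg_ex; eexists; exact: cvgA.
near=> k; have k0 : 0 < k.+1%:R^-1 :> R by rewrite invr_gt0.
have [_ [sb Ssb <-] hsb] := lb_ereal_inf_adherent k0 fin.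
apply: (oracle_probability hPX hmodels_countable hDelta_ge0 hDelta hnet_countable
  hpen xi0 Ssb (pen_gt0 Ssb) hcl) => // w.
rewrite /A /= lee_fin => /le_trans; apply.
rewrite /oracle_bound -/c [leRHS]addrAC lerD2r ltW //.
by move: hsb; rewrite -[ereal_inf _]/(oracle s) -(fineK fin) -EFinD lte_fin.
Unshelve. all: by end_near.
Qed.

(** The oracle is tested at a net point [t] close to a point [u] of [Sb] close to [s]. Then
    [h^2(s, t) <= 2 h^2(s, u) + 2 h^2(u, t)] explains the factor [2 c_1], and [8 c_2 pen t] is at
    most [c_2 D + c_3 Delta Sb]. *)
Lemma oracle_le_dimension s Sb : models Sb ->
  (forall t, bS t -> ((pen t)%:E <= pen1 P X models Delta net t)%E) ->
  (oracle s <= (2 * c1 R)%:E * Hdist_set2 s Sb + dimension_bound P X Sb (net Sb)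
     + (c3 R * Delta Sb)%:E)%E.
Proof.
move=> mSb hpen; have c10 := c1_ge0; have c20 := ltW c2_gt0.
have h1 : (0 <= (2 * c1 R)%:E * Hdist_set2 s Sb)%E.
  by rewrite mule_ge0 ?Hdist_set2_ge0 // lee_fin mulr_ge0.
have h2 : (0 <= (2 * c1 R)%:E * esup0 [set Hdist_set2 u (net Sb) | u in Sb])%E.
  by rewrite mule_ge0 ?esup0_Hdist_set2_ge0 // lee_fin mulr_ge0.
rewrite /dimension_bound; set Q := Hdist_set2 s Sb in h1 *.
set sg := esup0 _ in h2 *; set D := max_dimension P X (net Sb).
have D1 : (1 <= D)%E by exact: max_dimension_ge1.
have D0 : (0 <= (c2 R)%:E * D)%E.
  by rewrite mule_ge0 ?lee_fin // (le_trans _ D1) // lee_fin.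
have [u0 Su0] := hmodels mSb.
have neNy (x : \bar R) : (0 <= x)%E -> x != -oo%E.
  by move=> x0; rewrite gt_eqF // (lt_le_trans _ x0) // ltNyr.
have c1p : 0 < 2 * c1 R.
  by rewrite /c1 !mulr_gt0 // addr_gt0 // mulr_gt0 // sqrtr_gt0.
(* If one of the three nonnegative terms is infinite, so is the right-hand side; otherwise the
   inequality is between reals. *)
have [eD|finD] := eqVneq D +oo%E.
  by rewrite eD gt0_muley ?lte_fin ?c2_gt0 // (addey (neNy _ h2)) (addey (neNy _ h1))
    addye // leey.
have [eS|finS] := eqVneq sg +oo%E.
  by rewrite eS gt0_muley ?lte_fin // (addye (neNy _ D0)) (addey (neNy _ h1))
    addye // leey.
have [eQ|finQ] := eqVneq Q +oo%E.
  by rewrite eQ gt0_muley ?lte_fin // (addye (neNy _ (adde_ge0 h2 D0))) addye // leey.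
have hD : D = (fine D)%:E by rewrite fineK // ge0_fin_numE ?ltey // (le_trans _ D1) // lee_fin.
have hS : sg = (fine sg)%:E by rewrite fineK // ge0_fin_numE ?ltey // esup0_Hdist_set2_ge0.
have hQ : Q = (fine Q)%:E by rewrite fineK // ge0_fin_numE ?ltey // Hdist_set2_ge0.
rewrite hD hS hQ -!EFinM -!EFinD; apply/lee_addgt0Pr => e e0.
(* Two approximations, each with weight [2 c_1], cost [e] in total. *)
have e'0 : 0 < e / (4 * c1 R) by rewrite divr_gt0 // mulr_gt0 //; lra.
have [u Su hu] : exists2 u, Sb u & Hdist2 s u <= fine Q + e / (4 * c1 R).
  by apply: Hdist_set2_adherent e'0; rewrite -hQ.
have [t St ht] : exists2 t, net Sb t & Hdist2 u t <= fine sg + e / (4 * c1 R).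
  apply: Hdist_set2_adherent e'0; rewrite -hS; apply: esup0_ge; by exists u.
have bt : bS t by exists Sb.
apply: (@le_trans _ _ (c1 R * Hdist2 s t + 8 * c2 R * pen t)%:E).
  by apply: ereal_inf_lbound; exists t.
have pt : pen t <= 1 / 8 * fine D + kappa R * Delta Sb.
  rewrite -lee_fin; apply: le_trans (hpen t bt) _.
  rewrite EFinD EFinM -hD; apply: ereal_inf_lbound; by exists Sb.
rewrite -EFinD lee_fin.
have hst : Hdist2 s t <= 2 * Hdist2 s u + 2 * Hdist2 u t.
  by have := Hdist2_quasi_triangle s u t ltr01; rewrite invr1.
have k1 := ler_wpM2l c10 hst; have k2 := ler_wpM2l c10 hu; have k3 := ler_wpM2l c10 ht.
have k4 := ler_wpM2l c20 pt.
have k5 : c1 R * (e / (4 * c1 R)) = e / 4 by field; rewrite gt_eqF //; lra.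
rewrite /c3; move: (e / (4 * c1 R)) k2 k3 k5 => e' k2 k3 k5.
move: k1 k2 k3 k4 k5; move: (c1 R) (c2 R) (kappa R) => a b k; lra.
Qed.

End Selection.

Theorem theorem31
  (R : realType) (n : nat) (hn : (3 <= n)%N)
  (d : 'I_n -> measure_display) (E : forall i, measurableType (d i))
  (mu : forall i, {measure set (E i) -> \bar R})
  (d' : measure_display) (Omega : measurableType d')
  (P : densities mu -> probability Omega R)
  (X : forall i, Omega -> E i)
  (hPX : density_experiment P X)
  (models : set (set (densities mu)))
  (hmodels_countable : countable models)
  (hmodels : forall Sb, models Sb -> is_model Sb)
  (Delta : set (densities mu) -> R)
  (hDelta_ge0 : forall Sb, models Sb -> 0 <= Delta Sb)
  (hDelta : (\esum_(Sb in models) (expR (- Delta Sb))%:E <= 1)%E)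
  (net : set (densities mu) -> set (densities mu))
  (hnet_countable : forall Sb, models Sb -> countable (net Sb))
  (hnet_identifiable : forall Sb, models Sb -> identifiable (net Sb))
  (hnet : forall Sb, models Sb ->
    (exists2 eta : R, 0 <= eta & is_net eta (net Sb) Sb)
    \/ dense_subset (net Sb) Sb)
  (pen : densities mu -> R) :
  let bS := \bigcup_(Sb in models) net Sb in
  (forall t, bS t -> 0 < pen t) ->
  (forall t, bS t -> (pen1 P X models Delta net t <= (pen t)%:E)%E) ->
  forall shat : Omega -> densities mu,
  Hmeasurable shat ->
  (forall w, Hclosure (rho_estimators (fun i => X i w) bS pen) (shat w)) ->
  (forall (s : densities mu) (xi : R), 0 < xi ->
     ((1 - expR (- xi))%:E <=
      P s [set w | (Hdist2 s (shat w))%:E <=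
        ereal_inf [set (c1 R * Hdist2 s sb + 8 * c2 R * pen sb)%:E | sb in bS]
        + (c3 R * (145 / 100 + xi))%:E])%E)
  /\
  ((forall t, bS t -> pen1 P X models Delta net t = (pen t)%:E) ->
   (forall Sb, models Sb ->
     (dimension_bound P X Sb (net Sb)
      <= model_dimension P X Sb + (c3 R / 20)%:E)%E) ->
   forall (s : densities mu) (xi : R), 0 < xi ->
     ((1 - expR (- xi))%:E <=
      P s [set w | (Hdist2 s (shat w))%:E <=
        ereal_inf [set (2 * c1 R)%:E * Hdist_set2 s Sb + model_dimension P X Sb
                       + (c3 R * (Delta Sb + 3 / 2 + xi))%:E | Sb in models]])%E).
Proof.
move=> bS pen_gt0 hpen shat hs hcl.
have hne Sb : models Sb -> Sb !=set0 by move=> /hmodels[].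
have ineq s xi : 0 < xi -> ((1 - expR (- xi))%:E <=
    P s [set w | (Hdist2 s (shat w))%:E <=
      oracle models net pen s + (c3 R * (145 / 100 + xi))%:E])%E.
  exact: (oracle_inequality hPX hmodels_countable hDelta_ge0 hDelta hnet_countable
    pen_gt0 s hpen hs hcl).
split=> [//|heq hdim s xi xi0].
apply: le_trans (ineq s xi xi0) _.
apply: le_measure; rewrite ?inE; [exact: Hmeasurable_ball..|].
move=> w /= /le_trans; apply; apply: le_ereal_inf_tmp => _ [Sb mSb <-].
have hpen' t : bS t -> ((pen t)%:E <= pen1 P X models Delta net t)%E.
  by move=> St; rewrite heq.
apply: (@le_trans _ _ ((2 * c1 R)%:E * Hdist_set2 s Sb
    + dimension_bound P X Sb (net Sb) + (c3 R * Delta Sb)%:E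
    + (c3 R * (145 / 100 + xi))%:E)%E).
  by apply: leeD2r; exact: (oracle_le_dimension hne s mSb hpen').
apply: (@le_trans _ _ ((2 * c1 R)%:E * Hdist_set2 s Sb
    + (model_dimension P X Sb + (c3 R / 20)%:E)
    + (c3 R * Delta Sb)%:E + (c3 R * (145 / 100 + xi))%:E)%E).
  by do 2 apply: leeD2r; apply: leeD2l; exact: hdim.
(* The constants combine as [145/100 + 1/20 = 3/2]. *)
rewrite -!addeA -!EFinD le_eqVlt; apply/orP; left; apply/eqP.
congr (_ + (_ + _%:E))%E; move: (c3 R) => c; by field.
Qed.
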